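(* Let $\mathbb{X}\subseteq\mathbb{P}^2$ be a $\Bbbk$-configuration of type $(1,2,\dots,s)$ with $s\ge2$, and assume there are exactly $s$ lines in $\mathbb{P}^2$ containing $s$ points of $\mathbb{X}$. Then $\Delta\mathbf{H}_{m\mathbb{X}}(ms-1)=s$ for all integers $m\ge2$.
   Context: $\Bbbk$ is an algebraically closed field and $R=\Bbbk[x_0,x_1,x_2]$. A $\Bbbk$-configuration of type $(d_1,\dots,d_s)$ is a finite set $\mathbb{X}\subseteq\mathbb{P}^2$ for which there exist integers $1\le d_1<\cdots<d_s$, subsets $\mathbb{X}_1,\dots,\mathbb{X}_s$ of $\mathbb{X}$ and distinct lines $\mathbb{L}_1,\dots,\mathbb{L}_s\subseteq\mathbb{P}^2$ such that (1) $\mathbb{X}=\bigcup_{i=1}^s\mathbb{X}_i$; (2) $|\mathbb{X}_i|=d_i$ and $\mathbb{X}_i\subseteq\mathbb{L}_i$ for each $i$; (3) for $1<i\le s$, $\mathbb{L}_i$ contains no point of $\mathbb{X}_j$ for any $j<i$. For $\mathbb{X}=\{P_1,\dots,P_n\}$ and $m\ge1$, $m\mathbb{X}$ is the fat point scheme with ideal $I_{m\mathbb{X}}=I_{P_1}^m\cap\cdots\cap I_{P_n}^m$, where $I_P$ is the ideal of $P$. $\mathbf{H}_\mathbb{Z}(t)=\dim_\Bbbk R_t-\dim_\Bbbk(I_\mathbb{Z})_t$ and $\Delta\mathbf{H}_\mathbb{Z}(t)=\mathbf{H}_\mathbb{Z}(t)-\mathbf{H}_\mathbb{Z}(t-1)$,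 with $\mathbf{H}_\mathbb{Z}(t)=0$ for $t<0$. *)

(* Defs.v *)
From HB Require Import structures.
From mathcomp Require Import all_boot all_order all_algebra.
Set Implicit Arguments. Unset Strict Implicit. Unset Printing Implicit Defensive.
Import Order.TTheory GRing.Theory Num.Theory.
Local Open Scope ring_scope.

Section Defs.
Variable K : fieldType.

(* R = K[x0,x1,x2], encoded as polynomials in x2 with coefficients in
   polynomials in x1 with coefficients in K[x0]. *)
Definition R3 := {poly {poly {poly K}}}.

Definition coef3 (f : R3) (i j k : nat) : K := ((f`_k)`_j)`_i.

Definition cst3 (c : K) : R3 := c%:P%:P%:P.

(* homogeneous of degree t (0 is homogeneous of every degree) *)
Definition homog (t : nat) (f : R3) : Prop :=
  forall i j k : nat, coef3 f i j k != 0 -> (i + j + k)%N = t.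

(* points of P^2 / lines of P^2 given by homogeneous coordinates *)
Definition pt := (K * K * K)%type.
Definition ptx (p : pt) := p.1.1.
Definition pty (p : pt) := p.1.2.
Definition ptz (p : pt) := p.2.
Definition scale3 (l : K) (p : pt) : pt := (l * ptx p, l * pty p, l * ptz p).
Definition nz3 (p : pt) : Prop := p <> (0, 0, 0).
Definition projeq (p q : pt) : Prop := exists l : K, l != 0 /\ p = scale3 l q.
Definition onl (p a : pt) : bool :=
  ptx a * ptx p + pty a * pty p + ptz a * ptz p == 0.

Definition eval3 (f : R3) (p : pt) : K :=
  ((f.[(ptz p)%:P%:P]).[(pty p)%:P]).[ptx p].

(* the homogeneous ideal I_P of the point P: polynomials all of whose
   homogeneous components vanish at P, i.e. f(l P) = 0 for all l *)
Definition IP (p : pt) (f : R3) : Prop := forall l : K, eval3 f (scale3 l p) = 0.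

(* the m-th power of an ideal I (m >= 1): finite sums of m-fold products *)
Definition powI (I : R3 -> Prop) (m : nat) (f : R3) : Prop :=
  exists (n : nat) (a : 'I_n -> 'I_m -> R3),
    (forall j i, I (a j i)) /\ f = \sum_(j < n) \prod_(i < m) a j i.

Definition isdim (S : R3 -> Prop) (n : nat) : Prop :=
  exists b : 'I_n -> R3,
    (forall c : 'I_n -> K, \sum_(i < n) cst3 (c i) * b i = 0 -> forall i, c i = 0) /\
    (forall f, S f <-> exists c : 'I_n -> K, f = \sum_(i < n) cst3 (c i) * b i).

Definition hilb (I : R3 -> Prop) (t : nat) (h : int) : Prop :=
  exists a b : nat, isdim (homog t) a /\ isdim (fun f => homog t f /\ I f) b /\
    h = a%:Z - b%:Z.

(* A k-configuration of type (1,2,...,s): X_i = {P i j | j <= i} (0-indexed,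
   so |X_i| = i+1), on lines L i. *)
Definition kconfig_1s (s : nat) (P : 'I_s -> 'I_s -> pt) (L : 'I_s -> pt) : Prop :=
  [/\ (forall i j : 'I_s, (j <= i)%N -> nz3 (P i j)),
      (forall i j i' j' : 'I_s, (j <= i)%N -> (j' <= i')%N -> ((i != i') || (j != j')) ->
        ~ projeq (P i j) (P i' j')),
      (forall i : 'I_s, nz3 (L i)) /\
      (forall i i' : 'I_s, i <> i' -> ~ projeq (L i) (L i')),
      (forall i j : 'I_s, (j <= i)%N -> onl (P i j) (L i)) &
      (forall i i' j' : 'I_s, (i' < i)%N -> (j' <= i')%N -> ~~ onl (P i' j') (L i))].

Definition npts_on (s : nat) (P : 'I_s -> 'I_s -> pt) (a : pt) : nat :=
  #|[set ij : 'I_s * 'I_s | (ij.2 <= ij.1)%N && onl (P ij.1 ij.2) a]|.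

Definition exactly_s_lines (s : nat) (P : 'I_s -> 'I_s -> pt) : Prop :=
  exists M : 'I_s -> pt,
    [/\ (forall k, nz3 (M k)),
        (forall k k', k <> k' -> ~ projeq (M k) (M k')),
        (forall k, npts_on P (M k) = s) &
        (forall a : pt, nz3 a -> npts_on P a = s -> exists k, projeq a (M k))].

Definition fatI (s : nat) (P : 'I_s -> 'I_s -> pt) (m : nat) (f : R3) : Prop :=
  forall i j : 'I_s, (j <= i)%N -> powI (IP (P i j)) m f.

End Defs.

(* Main.v *)
(* Let M_1, ..., M_s be the lines through s points.  Each point of X lies on at
   least one M_k, and counting incidences in the s(s+1)/2 points shows that X
   consists of the pairwise intersections of the M_k and of one further point
   Q_k on each M_k, the Q_k not being collinear since a line through all of them
   would be another line with s points.  In degrees ms-1 and ms-2 Bezout's theorem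
   makes M_1 ... M_s divide every form of the ideal of mX; the quotients form, in
   degrees ns-1 and ns-2 with n = m-1, an ideal J of fat points.  For a linear
   form x vanishing at no point of X, multiplication by x gives
   dim J_(ns-1) - dim J_(ns-2) = ns as soon as R = J + (x) in degree ns-1.
   This is checked with explicit products of lines: two lines meeting off x
   generate, together with x, all forms of positive degree, so any form can be
   rewritten modulo x until it is divisible by M_j^(n-1) for all j other than some
   k, then by a line Q_k Q_l, and the remaining vanishing at the Q_j is obtained
   from arbitrary lines through them, because modulo x every linear form is a line
   through a given point off x.  Hence the difference of the Hilbert function is
   ms - ns = s. *)
Require Import Defs.
From HB Require Import structures.
From mathcomp Require Import all_boot all_order all_algebra.
From mathcomp Require Import ring zify.
From Stdlib Require Import Classical.
Set Implicit Arguments. Unset Strict Implicit. Unset Printing Implicit Defensive.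
Import Order.TTheory GRing.Theory Num.Theory.
Local Open Scope ring_scope.

(** * Polynomial rings in three variables *)

(* The polynomial ring, known only through its generators and its universal
   property; the nested encoding [R3] enters again in [R3_polyring]. *)
Record polyring3 (K : fieldType) := Polyring3 {
  p3ring :> idomainType;
  cst : {rmorphism K -> p3ring};
  X0 : p3ring; X1 : p3ring; X2 : p3ring;
  polyring3_ind : forall T : p3ring -> Prop,
    (forall c, T (cst c)) -> T X0 -> T X1 -> T X2 ->
    (forall f g, T f -> T g -> T (f + g)) ->
    (forall f g, T f -> T g -> T (f * g)) -> forall f, T f;
  subst : forall S : comNzRingType, {rmorphism K -> S} -> S -> S -> S ->
    {rmorphism p3ring -> S};
  substC : forall S phi a b c y, @subst S phi a b c (cst y) = phi y;
  substX0 : forall S phi a b c, @subst S phi a b c X0 = a;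
  substX1 : forall S phi a b c, @subst S phi a b c X1 = b;
  substX2 : forall S phi a b c, @subst S phi a b c X2 = c }.

Definition substE := (substC, substX0, substX1, substX2).

Arguments cst {K _}. Arguments X0 {K _}. Arguments X1 {K _}. Arguments X2 {K _}.
Arguments subst {K _ S}.

Section Substitution.
Variables (K : fieldType) (R : polyring3 K).
Implicit Types f g : R.

(** Uniqueness in the universal property. To compare two compound expressions in [f], each is first
    written as one ring morphism applied to [f]; only the generators are left to check. *)
Lemma polyring3_rmorph_eq (S : comNzRingType) (u v : {rmorphism R -> S}) :
  (forall c, u (cst c) = v (cst c)) -> u X0 = v X0 -> u X1 = v X1 ->
  u X2 = v X2 -> u =1 v.
Proof.
move=> ec e0 e1 e2; apply: polyring3_ind => // f g ef eg.
  by rewrite !rmorphD ef eg.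
by rewrite !rmorphM ef eg.
Qed.

Definition ev (p : pt K) : {rmorphism R -> K} :=
  subst idfun (ptx p) (pty p) (ptz p).

Definition lin (a : pt K) : R :=
  cst (ptx a) * X0 + cst (pty a) * X1 + cst (ptz a) * X2.

Definition dot (a p : pt K) : K := ptx a * ptx p + pty a * pty p + ptz a * ptz p.

Lemma subst_lin (S : comNzRingType) (phi : {rmorphism K -> S}) a b c l :
  subst phi a b c (lin l) =
  phi (ptx l) * a + phi (pty l) * b + phi (ptz l) * c.
Proof. by rewrite /lin !rmorphD !rmorphM !substE. Qed.

Lemma ev_lin a p : ev p (lin a) = dot a p.
Proof. exact: subst_lin. Qed.

Lemma dot_scale a l p : dot a (scale3 l p) = l * dot a p.
Proof. by rewrite /dot /scale3 /ptx /pty /ptz /=; ring. Qed.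

End Substitution.
Arguments ev {K R}. Arguments lin {K R}.

(** * Forms of a given degree *)

Section Homogeneous.
Variables (K : fieldType) (R : polyring3 K).
Implicit Types f g : R.

Definition mono3 (c : K) (i j k : nat) : R :=
  cst c * X0 ^+ i * X1 ^+ j * X2 ^+ k.

Definition theta : {rmorphism R -> {poly R}} :=
  subst (polyC \o cst) (X0%:P * 'X) (X1%:P * 'X) (X2%:P * 'X).

Lemma theta_mono c i j k :
  theta (mono3 c i j k) = (mono3 c i j k)%:P * 'X^(i + j + k).
Proof.
rewrite /mono3 3!(rmorphM theta) 3!(rmorphXn theta) /theta.
rewrite substC substX0 substX1 substX2 /= !polyCM !polyC_exp !exprMn !exprD.
by ring.
Qed.

(* [f] is homogeneous of degree [t]: substituting x_i T for x_i multiplies [f] by T^t. *)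
Definition tform t f := theta f = f%:P * 'X^t.

Lemma tformD t f g : tform t f -> tform t g -> tform t (f + g).
Proof. by rewrite /tform => ef eg; rewrite !rmorphD ef eg mulrDl. Qed.

Lemma tformM t u f g : tform t f -> tform u g -> tform (t + u) (f * g).
Proof. by rewrite /tform => ef eg; rewrite !rmorphM ef eg exprD mulrACA. Qed.

Lemma tformC c : tform 0 (cst c).
Proof. by rewrite /tform /theta substC /= mulr1. Qed.

Lemma tform1 : tform 0 1.
Proof. by rewrite /tform rmorph1 mulr1. Qed.

Lemma tformX0 : tform 1 X0.
Proof. by rewrite /tform /theta substX0. Qed.
Lemma tformX1 : tform 1 X1.
Proof. by rewrite /tform /theta substX1. Qed.
Lemma tformX2 : tform 1 X2.
Proof. by rewrite /tform /theta substX2. Qed.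

Lemma tformCM c t f : tform t f -> tform t (cst c * f).
Proof. exact: tformM (tformC c). Qed.

Lemma tform0 t : tform t 0.
Proof. by rewrite /tform !rmorph0 mul0r. Qed.

Lemma tform_mono c i j k : tform (i + j + k) (mono3 c i j k).
Proof. exact: theta_mono. Qed.

Lemma tform_sum (I : Type) (r : seq I) (T : pred I) (F : I -> R) t :
  (forall i, T i -> tform t (F i)) -> tform t (\sum_(i <- r | T i) F i).
Proof.
by move=> hF; elim/big_ind: _ => //; [exact: tform0 | exact: tformD].
Qed.

Lemma tform_lin a : tform 1 (lin a).
Proof.
by do 2?[apply: tformD]; apply: tformCM;
  [exact: tformX0|exact: tformX1|exact: tformX2].
Qed.

Lemma tform_prod (I : Type) (r : seq I) (T : pred I) (F : I -> R) (e : I -> nat) :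
  (forall i, T i -> tform (e i) (F i)) ->
  tform (\sum_(i <- r | T i) e i) (\prod_(i <- r | T i) F i).
Proof.
move=> hF; elim/big_rec2: _ => [|i n f Ti hf]; first exact: tform1.
by apply: tformM hf; apply: hF.
Qed.

Lemma tform_cancel t u f g : f != 0 -> tform t f -> tform (t + u) (f * g) ->
  tform u g.
Proof.
rewrite /tform => f0 ef; rewrite rmorphM ef exprD rmorphM mulrACA => e.
have h : f%:P * 'X^t != 0 by rewrite mulf_neq0 ?polyC_eq0 // -size_poly_eq0 size_polyXn.
exact: (mulfI h).
Qed.

(* The coefficients of [theta f] are the homogeneous components of [f]. *)
Lemma tform_ind t (T : R -> Prop) : T 0 ->
  (forall f g, T f -> T g -> T (f + g)) ->
  (forall c i j k, (i + j + k)%N = t -> T (mono3 c i j k)) ->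
  forall f, tform t f -> T f.
Proof.
move=> T0 TD Tm f hf.
(* [comp r g] presents [g] as a finite sum of monomials of degree [r]. It is proved for all
   coefficients of [theta g] with [g] arbitrary, since induction on the generators does not stay
   among forms. *)
pose comp r g := exists n (c : 'I_n -> K) (i j k : 'I_n -> nat),
  (forall l, (i l + j l + k l)%N = r) /\ g = \sum_l mono3 (c l) (i l) (j l) (k l).
have comp1 c i j k : comp (i + j + k)%N (mono3 c i j k).
  exists 1%N, (fun=> c), (fun=> i), (fun=> j), (fun=> k).
  by rewrite big_ord1.
have comp0 r : comp r 0.
  exists 0%N, (fun=> 0), (fun=> 0%N), (fun=> 0%N), (fun=> 0%N).
  by rewrite big_ord0; split=> // -[].
have compD r g h : comp r g -> comp r h -> comp r (g + h).
  move=> [n1 [c1 [i1 [j1 [k1 [e1 ->]]]]]] [n2 [c2 [i2 [j2 [k2 [e2 ->]]]]]].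
  pose s A (u : 'I_n1 -> A) (v : 'I_n2 -> A) (l : 'I_(n1 + n2)) : A :=
    match split l with inl l => u l | inr l => v l end.
  exists (n1 + n2)%N, (s _ c1 c2), (s _ i1 i2), (s _ j1 j2), (s _ k1 k2).
  split=> [l|]; first by rewrite /s; case: (split l).
  rewrite big_split_ord /s; congr (_ + _); apply: eq_bigr => l _.
    by rewrite !(unsplitK (inl l)).
  by rewrite !(unsplitK (inr l)).
have comp_sum r (n : nat) (F : 'I_n -> R) :
    (forall l, comp r (F l)) -> comp r (\sum_l F l).
  by move=> hF; elim/big_ind: _ => //; exact: compD.
have compM r u g h : comp r g -> comp u h -> comp (r + u)%N (g * h).
  move=> [n1 [c1 [i1 [j1 [k1 [e1 ->]]]]]] [n2 [c2 [i2 [j2 [k2 [e2 ->]]]]]].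
  rewrite mulr_suml; apply: (comp_sum) => l; rewrite mulr_sumr; apply: comp_sum => l'.
  have -> : mono3 (c1 l) (i1 l) (j1 l) (k1 l) * mono3 (c2 l') (i2 l') (j2 l') (k2 l')
    = mono3 (c1 l * c2 l') (i1 l + i2 l') (j1 l + j2 l') (k1 l + k2 l').
    by rewrite /mono3 rmorphM !exprD; ring.
  have -> : (r + u = i1 l + i2 l' + (j1 l + j2 l') + (k1 l + k2 l'))%N.
    by rewrite -(e1 l) -(e2 l'); lia.
  exact: comp1.
have compX g : comp 1%N g -> forall r, comp r (g%:P * 'X)`_r.
  by move=> hg r; rewrite coefMX; case: r => [|[|r]] //=; rewrite coefC.
have all_comp g r : comp r (theta g)`_r.
  move: g r; apply: polyring3_ind => [c r||||g h hg hh r|g h hg hh r].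
  - rewrite /theta substC coefC; case: r => [|r] //=.
    by have := comp1 c 0 0 0; rewrite /mono3 !mulr1.
  - rewrite /theta substE; apply: compX; have := comp1 1 1 0 0.
    by rewrite /mono3 rmorph1 mul1r !mulr1.
  - rewrite /theta substE; apply: compX; have := comp1 1 0 1 0.
    by rewrite /mono3 rmorph1 !mul1r mulr1.
  - rewrite /theta substE; apply: compX; have := comp1 1 0 0 1.
    by rewrite /mono3 rmorph1 !mul1r.
  - by rewrite rmorphD coefD; apply: compD.
  rewrite rmorphM coefM; apply: comp_sum => l.
  have e : (l + (r - l))%N = r by rewrite subnKC // -ltnS.
  by rewrite -[X in comp X _]e; apply: compM.
have := all_comp f t; rewrite hf coefMXn ltnn subnn coefC eqxx.
by move=> [n [c [i [j [k [e ->]]]]]]; elim/big_ind: _ => // l _; apply: Tm.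
Qed.

Lemma tform_gen t f : tform t.+1 f -> exists f0 f1 f2,
  [/\ tform t f0, tform t f1, tform t f2 & f = X0 * f0 + X1 * f1 + X2 * f2].
Proof.
move=> hf; pose T g := exists f0 f1 f2,
  [/\ tform t f0, tform t f1, tform t f2 & g = X0 * f0 + X1 * f1 + X2 * f2].
move: f hf; apply: (@tform_ind _ T) => [|g h|c i j k].
- by exists 0, 0, 0; split; try exact: tform0; rewrite !mulr0 !addr0.
- move=> [g0 [g1 [g2 [G0 G1 G2 ->]]]] [h0 [h1 [h2 [H0 H1 H2 ->]]]].
  by exists (g0 + h0), (g1 + h1), (g2 + h2); split; try exact: tformD; ring.
have hm i' j' k' : (i' + j' + k')%N = t -> tform t (mono3 c i' j' k').
  by move=> <-; exact: tform_mono.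
have h0 := tform0 t.
case: i => [|i].
  case: j => [|j].
    case: k => // k [e]; exists 0, 0, (mono3 c 0 0 k); split=> //; first exact: hm.
    by rewrite /mono3 exprS; ring.
  move=> e; exists 0, (mono3 c 0 j k), 0; split=> //; first by apply: hm; lia.
  by rewrite /mono3 exprS; ring.
move=> e; exists (mono3 c i j k), 0, 0; split=> //; first by apply: hm; lia.
by rewrite /mono3 exprS; ring.
Qed.

(** Substituting in the coefficients of [theta f] and then setting T = [l] multiplies the images of
    the generators by [l]; on a form it produces the factor [l ^+ t]. In [res_eq0_dvd] the ring [S]
    is a fraction field. *)
Lemma tform_scale (S : comNzRingType) (phi : {rmorphism K -> S}) (l a b c : S) t f :
  tform t f -> subst phi (l * a) (l * b) (l * c) f = l ^+ t * subst phi a b c f.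
Proof.
move=> hf; pose v : {rmorphism R -> S} := subst phi a b c.
pose u : {rmorphism R -> S} := horner_eval l \o map_poly v \o theta.
have uE g n : (map_poly v (g%:P * 'X^n)).[l] = l ^+ n * v g.
  by rewrite rmorphM /= map_polyC map_polyXn hornerM hornerC hornerXn mulrC.
transitivity (u f); last by rewrite -uE -hf.
apply: polyring3_rmorph_eq => [y|||]; rewrite /u /= /theta !substE /horner_eval.
- by rewrite map_polyC hornerC /= /v substC.
- by rewrite -['X]expr1 uE expr1 /v substX0.
- by rewrite -['X]expr1 uE expr1 /v substX1.
- by rewrite -['X]expr1 uE expr1 /v substX2.
Qed.

End Homogeneous.

(** * Powers of the ideal of a point *)

(** A non-root of the product of the X - z over the elements already found is a new element. *)
Lemma uniq_seq_exists (K : closedFieldType) N :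
  exists rs : seq K, uniq rs /\ size rs = N.
Proof.
elim: N => [|N [rs [rs_uniq rs_size]]]; first by exists [::].
have /closed_nonrootP[y] : \prod_(z <- rs) ('X - z%:P) != 0.
  by rewrite monic_neq0 // monic_prod_XsubC.
by rewrite root_prod_XsubC => hy; exists (y :: rs); rewrite /= hy rs_uniq rs_size.
Qed.

Section Vanishing.
Variable K : fieldType.
Hypothesis K_infinite : forall N, exists rs : seq K, uniq rs /\ size rs = N.

Lemma poly_vanish (D : idomainType) (iota : {rmorphism K -> D}) (g : {poly D}) :
  (forall y, g.[iota y] = 0) -> g = 0.
Proof.
move=> hg; apply/eqP; case: eqVneq => // g0.
have [rs [rs_uniq rs_size]] := K_infinite (size g).
have := @max_poly_roots _ g (map iota rs) g0.
rewrite size_map rs_size ltnn map_inj_uniq; last exact: fmorph_inj.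
move/(_ _ rs_uniq) => -> //; apply/allP => _ /mapP[y _ ->].
by rewrite /root hg.
Qed.

End Vanishing.

Section IdealPower.
Variables (R : comNzRingType) (I : R -> Prop).
Hypothesis I_mulr : forall f g, I g -> I (f * g).
Implicit Types f g : R.

(** The expression of [powI] over an arbitrary ring. For m = 0 the products are empty and only sums
    of ones arise, not the whole ring; hence the positive exponents in the absorption lemmas. *)
Definition idealX (m : nat) (f : R) : Prop :=
  exists (n : nat) (a : 'I_n -> 'I_m -> R),
    (forall j i, I (a j i)) /\ f = \sum_(j < n) \prod_(i < m) a j i.

Lemma idealX0 m : idealX m 0.
Proof.
by exists 0%N, (fun _ _ => 0); split=> [[]|] //; rewrite big_ord0.
Qed.

Lemma idealXD m f g : idealX m f -> idealX m g -> idealX m (f + g).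
Proof.
move=> [n1 [a1 [I1 ->]]] [n2 [a2 [I2 ->]]].
exists (n1 + n2)%N, (fun j => match split j with inl j => a1 j | inr j => a2 j end).
split=> [j i|]; first by case: (split j).
by rewrite big_split_ord; congr (_ + _); apply: eq_bigr => j _;
  rewrite (unsplitK (inl j)) || rewrite (unsplitK (inr j)).
Qed.

Lemma idealX_sum (J : Type) (r : seq J) (T : pred J) (F : J -> R) m :
  (forall j, T j -> idealX m (F j)) -> idealX m (\sum_(j <- r | T j) F j).
Proof.
by move=> hF; elim/big_ind: _ => //; [exact: idealX0|exact: idealXD].
Qed.

Lemma idealX_prod m (a : 'I_m -> R) :
  (forall i, I (a i)) -> idealX m (\prod_(i < m) a i).
Proof.
by move=> Ia; exists 1%N, (fun _ => a); split=> //; rewrite big_ord1.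
Qed.

Lemma idealX1 f : I f -> idealX 1 f.
Proof. by exists 1%N, (fun _ _ => f); split=> //; rewrite !big_ord1. Qed.

Lemma idealXM m n f g : idealX m f -> idealX n g -> idealX (m + n) (f * g).
Proof.
move=> [n1 [a1 [I1 ->]]] [n2 [a2 [I2 ->]]].
rewrite mulr_suml; apply: idealX_sum => j _; rewrite mulr_sumr.
apply: idealX_sum => l _.
pose a i := match split i with inl i => a1 j i | inr i => a2 l i end.
have -> : (\prod_(i < m) a1 j i) * (\prod_(i < n) a2 l i) = \prod_(i < m + n) a i.
  rewrite big_split_ord /a; congr (_ * _); apply: eq_bigr => i _.
    by rewrite (unsplitK (inl i)).
  by rewrite (unsplitK (inr i)).
by apply: idealX_prod => i; rewrite /a; case: (split i).
Qed.

Lemma idealX_mulr m f g : idealX m.+1 g -> idealX m.+1 (f * g).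
Proof.
move=> [n [a [Ia ->]]]; rewrite mulr_sumr; apply: idealX_sum => j _.
rewrite big_ord_recl mulrA.
pose b i := if unlift ord0 i is Some i' then a j (lift ord0 i') else f * a j ord0.
have -> : f * a j ord0 * (\prod_(i < m) a j (lift ord0 i)) = \prod_(i < m.+1) b i.
  rewrite big_ord_recl /b unlift_none; congr (_ * _).
  by apply: eq_bigr => i _; rewrite liftK.
by apply: idealX_prod => i; rewrite /b; case: unliftP => [i' _|_] //; apply: I_mulr.
Qed.

Lemma idealX_le m n g : (m < n)%N -> idealX n g -> idealX m.+1 g.
Proof.
move=> /subnKC <- [k [a [Ia ->]]]; apply: idealX_sum => j _.
by rewrite big_split_ord /= mulrC; apply/idealX_mulr/idealX_prod.
Qed.

End IdealPower.

Section Segment.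
Variable A : comNzRingType.
Implicit Types a f g : A.

Definition segment g f : {poly A} := g%:P + (f - g)%:P * 'X.

Lemma segment_linear a g g' f f' :
  segment (a * g + g') (a * f + f') = a%:P * segment g f + segment g' f'.
Proof. by rewrite /segment !(polyCB, polyCD, polyCM); ring. Qed.

Lemma segment0 : segment 0 0 = 0.
Proof. by rewrite /segment subr0 polyC0 mul0r addr0. Qed.

Lemma segmentxx f : segment f f = f%:P.
Proof. by rewrite /segment subrr mul0r addr0. Qed.

Lemma segment_horner1 g f : (segment g f).[1] = f.
Proof. by rewrite /segment hornerD hornerM !hornerC hornerX mulr1 addrC subrK. Qed.

Lemma segment_horner0 g f : (segment g f).[0] = g.
Proof. by rewrite /segment hornerD hornerM !hornerC hornerX mulr0 addr0. Qed.

Lemma segment_coefS g f r : (segment g f)`_r.+1 = (f - g) *+ (r == 0).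
Proof. by rewrite /segment coefD coefC coefMX coefC add0r /=; case: r. Qed.

End Segment.

Section Order.
Variables (K : fieldType) (R : polyring3 K) (xi p : pt K).
Hypothesis K_infinite : forall N, exists rs : seq K, uniq rs /\ size rs = N.
Hypothesis xip : dot xi p != 0.
Implicit Types f g : R.

Definition ptI f : Prop := forall l, ev (scale3 l p) f = 0.

Lemma ptI_mulr f g : ptI g -> ptI (f * g).
Proof. by move=> hg l; rewrite rmorphM hg mulr0. Qed.

(** Meant for a linear form [f] with value [v] at [p]: the constant term is then the multiple of
    [lin xi] with the same value at [p], so the coefficient of T vanishes at [p]. *)
Definition psi_coord (v : K) (f : R) : {poly R} :=
  segment (cst (v / dot xi p) * lin xi) f.

(* [psi] fixes [lin xi] and multiplies by T the linear forms vanishing at [p]: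
   it reads off the filtration of the ring by the powers of [ptI]. *)
Definition psi : {rmorphism R -> {poly R}} :=
  subst (polyC \o cst)
    (psi_coord (ptx p) X0) (psi_coord (pty p) X1) (psi_coord (ptz p) X2).

Lemma psi_coord_linear a v w f g :
  psi_coord (a * v + w) (cst a * f + g) =
  (cst a)%:P * psi_coord v f + psi_coord w g.
Proof.
rewrite -segment_linear; congr segment.
have -> : cst ((a * v + w) / dot xi p) =
    cst a * cst (v / dot xi p) + cst (w / dot xi p) :> R.
  by rewrite mulrDl -[a * v / _]mulrA rmorphD rmorphM.
by rewrite [LHS]mulrDl mulrA.
Qed.

Lemma psi_coord0 : psi_coord 0 0 = 0.
Proof.
have e : cst (0 / dot xi p) * lin xi = 0 :> R.
  by rewrite (mul0r (_^-1)) rmorph0 mul0r.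
by rewrite /psi_coord e segment0.
Qed.

Lemma psi_lin a : psi (lin a) = psi_coord (dot a p) (lin a).
Proof.
transitivity (psi_coord
    (ptx a * ptx p + (pty a * pty p + (ptz a * ptz p + 0)))
    (cst (ptx a) * X0 + (cst (pty a) * X1 + (cst (ptz a) * X2 + 0)))).
  by rewrite 3!psi_coord_linear psi_coord0 addr0 addrA; exact: subst_lin.
by congr psi_coord; rewrite addr0 addrA.
Qed.

Lemma psi_xi : psi (lin xi) = (lin xi)%:P.
Proof.
by rewrite psi_lin /psi_coord divff // rmorph1 mul1r segmentxx.
Qed.

Lemma psi1 f : (psi f).[1] = f.
Proof.
pose u : {rmorphism R -> R} := horner_eval 1 \o psi.
have -> : (psi f).[1] = u f by [].
pose v : {rmorphism R -> R} := idfun.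
suff -> : u f = v f by [].
have h w g : (psi_coord w g).[1] = g by exact: segment_horner1.
apply: polyring3_rmorph_eq => [c|||]; rewrite /u /= /psi substE /horner_eval ?h //.
by rewrite /= hornerC.
Qed.

(** At T = 0 every generator becomes a multiple of [lin xi], so the constant term is a one-variable
    polynomial [g] evaluated at [lin xi]. This [g] is the restriction of [f] to the multiples of
    [p]; it vanishes on the infinite field K, hence is zero. *)
Lemma psi_coef0 f : ptI f -> (psi f)`_0 = 0.
Proof.
move=> hf; pose d := dot xi p.
pose g := subst polyC ((ptx p / d) *: 'X) ((pty p / d) *: 'X) ((ptz p / d) *: 'X) f.
have g0 : g = 0.
  apply: (@poly_vanish _ K_infinite _ idfun) => l /=; rewrite -(hf (l / d)).
  pose u : {rmorphism R -> K} := horner_eval l \o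
    subst polyC ((ptx p / d) *: 'X) ((pty p / d) *: 'X) ((ptz p / d) *: 'X).
  have -> : g.[l] = u f by [].
  apply: polyring3_rmorph_eq => [c|||]; rewrite /u /= /ev !substE /horner_eval ?hornerC //;
  by rewrite hornerZ hornerX /scale3 /ptx /pty /ptz /= mulrAC -mulrA mulrC.
pose rho : {rmorphism {poly K} -> R} :=
  horner_morph (fun y => mulrC (lin xi) (cst y)).
have rhoC y : rho y%:P = cst y by exact: horner_morphC.
have rhoX : rho 'X = lin xi by exact: horner_morphX.
have -> : (psi f)`_0 = rho g.
  rewrite -horner_coef0.
  pose u : {rmorphism R -> R} := horner_eval 0 \o psi.
  pose v : {rmorphism R -> R} := rho \o
    subst polyC ((ptx p / d) *: 'X) ((pty p / d) *: 'X) ((ptz p / d) *: 'X).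
  rewrite -[LHS]/(u f) -[RHS]/(v f).
  have h w (g' : R) : (psi_coord w g').[0] = rho ((w / d) *: 'X).
    rewrite [LHS]segment_horner0.
    by rewrite -mul_polyC (rmorphM rho) rhoC rhoX.
  apply: polyring3_rmorph_eq => [c|||]; rewrite /u /v /= /psi !substE /horner_eval ?h //.
  by rewrite [LHS]hornerC rhoC.
by rewrite g0 rmorph0.
Qed.

(** Divisibility of [psi f] by T^m. By [idealX_ord] this is membership in the m-th power of the
    ideal of [p], in a form that adds up along products and allows cancelling [lin xi]. *)
Definition ord m f := forall i, (i < m)%N -> (psi f)`_i = 0.

Lemma ordD m f g : ord m f -> ord m g -> ord m (f + g).
Proof. by move=> hf hg i im; rewrite rmorphD coefD hf ?hg ?addr0. Qed.

Lemma ord_sum (J : Type) (r : seq J) (T : pred J) (F : J -> R) m :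
  (forall j, T j -> ord m (F j)) -> ord m (\sum_(j <- r | T j) F j).
Proof.
move=> hF; elim/big_ind: _ => //; last exact: ordD.
by move=> i _; rewrite rmorph0 coef0.
Qed.

Lemma ordM m n f g : ord m f -> ord n g -> ord (m + n) (f * g).
Proof.
move=> hf hg i imn; rewrite rmorphM coefM big1 // => j _.
have [jm|mj] := ltnP j m; first by rewrite hf ?mul0r.
rewrite hg ?mulr0 // ltn_subLR; last by rewrite -ltnS.
by apply: leq_trans imn _; rewrite leq_add2r.
Qed.

Lemma ord0f f : ord 0 f. Proof. by []. Qed.

Lemma ord_le m n f : (m <= n)%N -> ord n f -> ord m f.
Proof. by move=> mn hf i im; apply: hf; apply: leq_trans im mn. Qed.

Lemma ord_mull m f g : ord m g -> ord m (f * g).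
Proof. exact: (@ordM 0). Qed.

Lemma ord_lin a : dot a p = 0 -> ord 1 (lin a).
Proof.
move=> ap [|//] _; apply: psi_coef0=> l; rewrite ev_lin.
by rewrite dot_scale ap mulr0.
Qed.

Lemma ordX m n f : ord m f -> ord (m * n) (f ^+ n).
Proof.
move=> hf; elim: n => [|n IH]; first by rewrite muln0.
by rewrite mulnS exprS; apply: ordM.
Qed.

Lemma ord_prod (J : Type) (r : seq J) (T : pred J) (F : J -> R) (e : J -> nat) :
  (forall j, T j -> ord (e j) (F j)) ->
  ord (\sum_(j <- r | T j) e j) (\prod_(j <- r | T j) F j).
Proof.
move=> hF; elim/big_rec2: _ => [|j n f Tj hf]; first exact: ord0f.
by apply: ordM hf; apply: hF.
Qed.

(** Since [psi] fixes [lin xi], multiplying by it multiplies each coefficient of [psi f] by the same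
    nonzero element of a domain. *)
Lemma ord_xi m f : ord m (lin xi * f) -> ord m f.
Proof.
move=> h i /h; rewrite rmorphM psi_xi coefCM => /eqP; rewrite mulf_eq0.
case/orP => /eqP // x0; case/negP: xip.
by rewrite -(ev_lin R) x0 rmorph0.
Qed.

(** For a generator only the coefficient of T matters, and it vanishes at [p]. In a product the
    exponents of the two coefficients add up; the two extreme terms are treated apart, because there
    one exponent is zero and that factor is merely absorbed. *)
Lemma psi_coef_pow f r : idealX ptI r.+1 (psi f)`_r.+1.
Proof.
have coord v g s : (forall l, ev (scale3 l p) g = l * v) ->
    idealX ptI s.+1 (psi_coord v g)`_s.+1.
  move=> hg; rewrite /psi_coord segment_coefS.
  case: s => [|s]; last exact: idealX0.
  rewrite mulr1n.
  apply: idealX1 => l; rewrite rmorphB (rmorphM (ev _)) hg ev_lin {1}/ev substC /=.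
  by rewrite dot_scale mulrCA divfK // mulrC subrr.
move: f r; apply: polyring3_ind => [c|r|r|r|f g hf hg r|f g hf hg r].
- by move=> r; rewrite /psi substE coefC; exact: idealX0.
- by rewrite {1}/psi substE; apply: coord => l; rewrite /ev substE.
- by rewrite {1}/psi substE; apply: coord => l; rewrite /ev substE.
- by rewrite {1}/psi substE; apply: coord => l; rewrite /ev substE.
- by rewrite rmorphD coefD; apply: idealXD.
rewrite rmorphM coefM; apply: idealX_sum => -[[|i] /= ir] _.
  by rewrite subn0; apply: idealX_mulr => //; exact: ptI_mulr.
move: ir; rewrite !ltnS leq_eqVlt => /predU1P[->|ir].
  by rewrite subnn mulrC; apply: idealX_mulr => //; exact: ptI_mulr.
have e : (r.+1 = i.+1 + (r - i.+1).+1)%N by lia.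
by rewrite {1}e subSS -(subnSK ir); apply: idealXM.
Qed.

(** One way, every factor has zero constant term under [psi]. The other way, [f] is [psi f] at T =
    1, the sum of its coefficients: those of index at most m vanish, and the others lie in the
    required power. *)
Lemma idealX_ord m f : idealX ptI m.+1 f <-> ord m.+1 f.
Proof.
split=> [[n [a [Ia ->]]]|hf].
  apply: ord_sum => j _.
  have h : ord (\sum_(i < m.+1) 1) (\prod_(i < m.+1) a j i).
    by apply: ord_prod => i _ [|//] _; exact: psi_coef0.
  by move: h; rewrite sum1_card card_ord.
rewrite -[f]psi1 horner_coef; apply: idealX_sum => i _; rewrite expr1n mulr1.
have [im|mi] := ltnP i m.+1; first by rewrite hf //; exact: idealX0.
move: mi; case: (nat_of_ord i) => // r mr.
exact: (idealX_le (@ptI_mulr) mr (psi_coef_pow f r)).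
Qed.

End Order.

(** * Dimensions of graded pieces *)

Section Dimension.
Variables (K : fieldType) (R : polyring3 K).
Implicit Types (f g : R) (S T : R -> Prop).

Definition spans_dim S (n : nat) : Prop :=
  exists b : 'I_n -> R,
    (forall c : 'I_n -> K, \sum_(i < n) cst (c i) * b i = 0 -> forall i, c i = 0) /\
    (forall f, S f <-> exists c : 'I_n -> K, f = \sum_(i < n) cst (c i) * b i).

Lemma spans_dim_iff S T n : (forall f, S f <-> T f) -> spans_dim S n -> spans_dim T n.
Proof.
by move=> ST [b [bfree bspan]]; exists b; split=> // f; rewrite -ST.
Qed.

Lemma spans_dim_mull S T n h : h != 0 -> spans_dim S n ->
  (forall f, T f <-> exists2 g, S g & f = h * g) -> spans_dim T n.
Proof.
move=> h0 [b [bfree bspan]] TS.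
have pull (c : 'I_n -> K) : \sum_i cst (c i) * (h * b i) = h * \sum_i cst (c i) * b i.
  by rewrite mulr_sumr; apply: eq_bigr => i _; rewrite mulrCA.
exists (fun i => h * b i); split=> [c|f].
  by rewrite pull => /eqP; rewrite mulf_eq0 (negbTE h0) => /eqP /bfree.
rewrite TS; split=> [[g /bspan[c ->] ->]|[c ->]]; first by exists c; rewrite pull.
by rewrite pull; eexists; last reflexivity; apply/bspan; exists c.
Qed.

(** [T] is a mere predicate, so a matrix is found by excluded middle: while some vector of [T]
    escapes the row space it is adjoined, and [d] bounds the number of times the rank can still
    grow. *)
Lemma subspace_mx n (T : 'rV[K]_n -> Prop) :
  T 0 -> (forall a u v, T u -> T v -> T (a *: u + v)) ->
  exists A : 'M[K]_n, forall v, T v <-> (v <= A)%MS.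
Proof.
move=> T0 TD.
suff grow d (A : 'M_n) : (forall v, (v <= A)%MS -> T v) -> (n - \rank A <= d)%N ->
    exists A : 'M[K]_n, forall v, T v <-> (v <= A)%MS.
  by apply: (@grow n 0) => [v|]; rewrite ?leq_subr // submx0 => /eqP ->.
elim: d A => [|d IH] A AT rA.
  exists A => v; split=> [_|]; last exact: AT.
  by apply: submx_full; rewrite /row_full eqn_leq rank_leq_row -subn_eq0 -leqn0.
have [[v [Tv vA]]|noT] := classic (exists v, T v /\ ~~ (v <= A)%MS); last first.
  exists A => v; split=> [Tv|]; last exact: AT.
  by apply/negP => /negP vA; case: noT; exists v.
apply: (IH (A + v)%MS) => [w /sub_addsmxP[[u1 u2] ->]|].
  have [a ->] : exists a, u2 *m v = a *: v.
    by exists (u2 0 0); rewrite [u2]mx11_scalar mul_scalar_mx !mxE.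
  by rewrite addrC; apply: TD => //; apply/AT/submxMl.
have : (A < A + v)%MS by rewrite ltmxE addsmxSl /= addsmx_sub submx_refl /=.
by rewrite ltmxErank => /andP[_]; lia.
Qed.

(** Gives the graded pieces of an ideal a dimension without computing it: [T] is pulled back to
    coordinate vectors, and a row basis is carried forward by [phi]. *)
Lemma spans_dim_sub S T n : spans_dim S n -> (forall f, T f -> S f) ->
  T 0 -> (forall f g, T f -> T g -> T (f + g)) ->
  (forall c f, T f -> T (cst c * f)) -> exists k, spans_dim T k.
Proof.
move=> [b [bfree bspan]] TS T0 TD TC.
pose phi (v : 'rV[K]_n) := \sum_i cst (v 0 i) * b i.
have phiD a u v : phi (a *: u + v) = cst a * phi u + phi v.
  rewrite /phi mulr_sumr -big_split /=; apply: eq_bigr => i _.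
  by rewrite !mxE rmorphD rmorphM mulrDl mulrA.
have phi0 : phi 0 = 0.
  by rewrite /phi big1 // => i _; rewrite mxE rmorph0 mul0r.
have phi_inj v : phi v = 0 -> v = 0.
  by move=> /bfree v0; apply/rowP => i; rewrite v0 mxE.
have phi_sum k (c : 'I_k -> K) (w : 'I_k -> 'rV[K]_n) :
    \sum_i cst (c i) * phi (w i) = phi (\sum_i c i *: w i).
  elim/big_rec2: _ => [|i u v _ ->]; first by rewrite phi0.
  by rewrite phiD.
have [|a u v Tu Tv|A AT] := @subspace_mx n (fun v => T (phi v)).
- by rewrite phi0.
- by rewrite phiD; apply: TD => //; apply: TC.
pose B := row_base A.
have TB v : T (phi v) <-> (v <= B)%MS by rewrite AT eq_row_base.
exists (\rank A), (fun i => phi (row i B)); split=> [c|f].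
  rewrite phi_sum => /phi_inj e i.
  have : (\row_i c i) *m B = 0.
    by rewrite mulmx_sum_row -[RHS]e; apply: eq_bigr => j _; rewrite mxE.
  rewrite -[0](mul0mx 1 B) => /(row_free_inj (row_base_free A)).
  by move/rowP/(_ i); rewrite !mxE.
split=> [Tf|[c ->]].
  have /bspan[c fE] := TS _ Tf.
  have fphi : f = phi (\row_i c i).
    by rewrite fE; apply: eq_bigr => i _; rewrite mxE.
  move: Tf; rewrite fphi TB => /submxP[u ->]; exists (u 0).
  by rewrite phi_sum mulmx_sum_row.
rewrite phi_sum TB; apply: summx_sub => i _; apply/scalemx_sub/row_sub.
Qed.

Local Notation mono3 := (@mono3 K R).

Variable xi : pt K.
Hypothesis xi_z : ptz xi = 1.
Local Notation x := (@lin K R xi).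

(* Reduction modulo [x]: the value of X2 is solved for. *)
Definition red : {rmorphism R -> {poly {poly K}}} :=
  subst (polyC \o polyC) 'X%:P 'X (- ((ptx xi)%:P%:P * 'X%:P + (pty xi)%:P%:P * 'X)).

Lemma red_xi : red x = 0.
Proof. by rewrite /red subst_lin /= xi_z mul1r subrr. Qed.

Lemma lin_xi_neq0 : x != 0.
Proof.
apply/eqP => /(congr1 (ev (0, 0, 1))); rewrite ev_lin rmorph0.
by rewrite /dot xi_z /ptx /pty /ptz /= !mulr0 !add0r mulr1 => /eqP; rewrite oner_eq0.
Qed.

Lemma tform_mod t f : tform t f -> exists (c : 'I_t.+1 -> K) g,
  f = \sum_i cst (c i) * mono3 1 i (t - i) 0 + x * g.
Proof.
pose T f := exists (c : 'I_t.+1 -> K) g,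
  f = \sum_i cst (c i) * mono3 1 i (t - i) 0 + x * g.
have TD f1 f2 : T f1 -> T f2 -> T (f1 + f2).
  move=> [c1 [g1 ->]] [c2 [g2 ->]]; exists (fun i => c1 i + c2 i), (g1 + g2).
  rewrite mulrDr addrACA; congr (_ + _); rewrite -big_split /=.
  by apply: eq_bigr => i _; rewrite rmorphD mulrDl.
have Tx g : T (x * g).
  exists (fun=> 0), g; rewrite big1 ?add0r // => i _.
  by rewrite rmorph0 mul0r.
move: f; apply: (@tform_ind _ _ _ T) => //; first by rewrite -(mulr0 x).
move=> c i j k.
elim: k i j c => [|k IH] i j c.
  rewrite addn0 => e; have it : (i < t.+1)%N by lia.
  exists (fun i' => if i' == Ordinal it then c else 0), 0.
  rewrite mulr0 addr0 (bigD1 (Ordinal it)) //= eqxx big1 => [|i' /negbTE ->].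
    have -> : (t - i = j)%N by lia.
    by rewrite /mono3 rmorph1; ring.
  by rewrite rmorph0 mul0r.
move=> e.
(* As [xi] has last coordinate 1, X2 is [x] minus a combination of X0 and X1: one factor X2 is
   traded for X0 or X1 modulo [x]. *)
have -> : mono3 c i j k.+1 = x * mono3 c i j k +
    (mono3 (- (ptx xi * c)) i.+1 j k + mono3 (- (pty xi * c)) i j.+1 k).
  by rewrite /mono3 /lin xi_z !rmorphN !rmorphM /= rmorph1 !exprS; ring.
by apply: (TD _ _ (Tx _)); apply: TD; apply: IH; lia.
Qed.

Lemma mono_free_mod t (c : 'I_t.+1 -> K) g :
  \sum_i cst (c i) * mono3 1 i (t - i) 0 + x * g = 0 -> forall i, c i = 0.
Proof.
move=> /(congr1 red) e i.
have : \sum_i ((c i *: 'X^i)%:P * 'X^(t - i) : {poly {poly K}}) = 0.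
  rewrite -[RHS](rmorph0 red) -e rmorphD (rmorphM red x) red_xi mul0r addr0.
  rewrite rmorph_sum; apply: eq_bigr => j _.
  rewrite /mono3 expr0 mulr1 rmorph1 mul1r 2!(rmorphM red) 2!(rmorphXn red).
  by rewrite /red substC substX0 substX1 /= mulrA -polyC_exp -polyCM -mul_polyC.
move/(congr1 (fun p : {poly {poly K}} => p`_(t - i)`_i)).
rewrite !coef0 coef_sum coef_sum (bigD1 i) //= big1 => [|j ji].
  by rewrite coefCM coefXn eqxx mulr1 coefZ coefXn eqxx mulr1 addr0.
rewrite coefCM coefXn; case: eqP => [|_]; last by rewrite mulr0 coef0.
move=> e'; case/eqP: ji; apply: val_inj => /=.
have := ltn_ord i; have := ltn_ord j; lia.
Qed.

(* Multiplication by the non-zero-divisor [x] embeds degree [t] into degree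
   [t.+1], with cokernel the binary forms of degree [t.+1]. *)
Lemma spans_dim_succ (J : R -> Prop) t n :
  (forall f g, J f -> J g -> J (f + g)) -> (forall c f, J f -> J (cst c * f)) ->
  (forall g, J (x * g) <-> J g) ->
  (forall f, tform t.+1 f -> exists F G, [/\ f = F + x * G, tform t.+1 F & J F]) ->
  spans_dim (fun f => tform t f /\ J f) n ->
  spans_dim (fun f => tform t.+1 f /\ J f) (n + t.+2).
Proof.
move=> JD JC Jx onto [b [bfree bspan]].
(* Each of the t + 2 monomials of degree t + 1 in X0 and X1 gets a representative in [J] modulo [x];
   these complete the basis. *)
have /fin_all_exists[F hF] (i : 'I_t.+2) : exists F, exists G,
    [/\ mono3 1 i (t.+1 - i) 0 = F + x * G, tform t.+1 F & J F].
  apply: onto; have := @tform_mono K R 1 i (t.+1 - i) 0.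
  by rewrite addn0 subnKC // -ltnS.
have {hF}/fin_all_exists[G hF] := hF.
have x0 := lin_xi_neq0.
have hx g : tform t.+1 (x * g) <-> tform t g.
  split=> h; last by rewrite -add1n; apply: tformM h; exact: tform_lin.
  by rewrite -add1n in h; apply: (tform_cancel x0 _ h); exact: tform_lin.
have J0 : J 0 by have := JC 0 _ (let: And3 _ _ h := hF ord0 in h); rewrite rmorph0 mul0r.
have F_sum (c : 'I_t.+2 -> K) : exists G', \sum_i cst (c i) * F i =
    \sum_i cst (c i) * mono3 1 i (t.+1 - i) 0 + x * G'.
  exists (- \sum_i cst (c i) * G i); rewrite mulrN mulr_sumr -sumrB.
  by apply: eq_bigr => i _; have [-> _ _] := hF i; ring.
have hFs c : tform t.+1 (\sum_i cst (c i) * F i).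
  by apply: tform_sum => i _; apply: tformCM; have [] := hF i.
have JFs c : J (\sum_i cst (c i) * F i).
  by elim/big_ind: _ => // i _; apply: JC; have [] := hF i.
pose B (k : 'I_(n + t.+2)) := match split k with inl i => x * b i | inr i => F i end.
have B_sum c : \sum_k cst (c k) * B k =
    x * (\sum_i cst (c (lshift t.+2 i)) * b i) + \sum_i cst (c (rshift n i)) * F i.
  rewrite big_split_ord /B mulr_sumr /=; congr (_ + _); apply: eq_bigr => i _.
    by rewrite (unsplitK (inl i)) mulrCA.
  by rewrite (unsplitK (inr i)).
exists B; split=> [c|f].
  have [G' FG] := F_sum (fun i => c (rshift n i)).
  rewrite B_sum => e0; have cr : forall i, c (rshift n i) = 0.
    by move: e0; rewrite FG addrCA -mulrDr; apply: mono_free_mod.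
  move: e0; rewrite [X in _ + X]big1 => [|i _]; last by rewrite cr rmorph0 mul0r.
  rewrite addr0 => /eqP; rewrite mulf_eq0 (negbTE x0) => /eqP /bfree cl k.
  by rewrite -[k]splitK; case: (split k) => i; [apply: cl|apply: cr].
split=> [[hf Jf]|[c ->]].
  (* Subtracting the combination of the [F i] congruent to [f] leaves a multiple of [x] lying in
     [J]; cancelling [x] gives an element of [J] in degree t. *)
  have [c [g fE]] := tform_mod hf; have [G' FG] := F_sum c.
  have {}fE : f = x * (g - G') + \sum_i cst (c i) * F i by rewrite fE FG; ring.
  have xg : x * (g - G') = f + cst (-1) * \sum_i cst (c i) * F i.
    by rewrite fE rmorphN rmorph1; ring.
  have /bspan[c' gE] : tform t (g - G') /\ J (g - G').
    rewrite -hx -Jx xg; split; first by apply: tformD => //; apply: tformCM.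
    by apply: JD => //; apply: JC.
  exists (fun k => match split k with inl i => c' i | inr i => c i end).
  rewrite B_sum fE gE; congr (x * _ + _); apply: eq_bigr => i _.
    by rewrite (unsplitK (inl i)).
  by rewrite (unsplitK (inr i)).
have [] : tform t (\sum_i cst (c (lshift t.+2 i)) * b i) /\
    J (\sum_i cst (c (lshift t.+2 i)) * b i) by apply/bspan; eexists.
by rewrite -hx -Jx B_sum => h1 j1; split; [apply: tformD|apply: JD].
Qed.

Lemma spans_dim_tform_succ t n :
  spans_dim (@tform K R t) n -> spans_dim (@tform K R t.+1) (n + t.+2).
Proof.
have T t' f : tform t' f <-> tform t' f /\ True by split=> [|[]].
move/(spans_dim_iff (T t)) => h; apply: spans_dim_iff (fun f => iff_sym (T _ f)) _.
apply: spans_dim_succ h => // f hf; exists f, 0; split=> //.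
by rewrite mulr0 addr0.
Qed.

Lemma spans_dim_tform t : exists n, spans_dim (@tform K R t) n.
Proof.
elim: t => [|t [n /spans_dim_tform_succ]]; last by eexists; eassumption.
exists 1%N, (fun=> 1); split=> [c|f].
  rewrite big_ord1 mulr1 => /eqP; rewrite fmorph_eq0 => /eqP e i.
  by rewrite ord1.
split=> [hf|[c ->]]; last by rewrite big_ord1 mulr1; exact: tformC.
suff [c ->] : exists c, f = cst c by exists (fun=> c); rewrite big_ord1 mulr1.
move: f hf; apply: tform_ind => [|g h [c ->] [c' ->]|c i j k].
- by exists 0; rewrite rmorph0.
- by exists (c + c'); rewrite rmorphD.
case: i j k => [|//] [|//] [|//] _; exists c.
by rewrite /mono3 !expr0 !mulr1.
Qed.

End Dimension.

(** * Lines of the plane and Bezout's theorem *)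

Section Geometry.
Variable K : fieldType.
Implicit Types a b c p q : pt K.

Definition cross a b : pt K :=
  (pty a * ptz b - ptz a * pty b, ptz a * ptx b - ptx a * ptz b,
   ptx a * pty b - pty a * ptx b).

Definition det a b c := dot (cross a b) c.

Lemma scale3K (l : K) p : l != 0 -> scale3 l^-1 (scale3 l p) = p.
Proof.
case: p => [[p0 p1] p2] l0; rewrite /scale3 /ptx /pty /ptz /=.
by rewrite !mulKf.
Qed.

Lemma dot_scalel a l p : dot (scale3 l a) p = l * dot a p.
Proof. by rewrite /dot /scale3 /ptx /pty /ptz /=; ring. Qed.

Lemma projeq_sym a b : projeq a b -> projeq b a.
Proof.
by move=> [l [l0 ->]]; exists l^-1; rewrite invr_eq0 l0 scale3K.
Qed.

Lemma cross_eq0_projeq a b : nz3 a -> nz3 b -> cross a b = (0, 0, 0) -> projeq a b.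
Proof.
case: a b => [[a0 a1] a2] [[b0 b1] b2] ha hb.
rewrite /cross /ptx /pty /ptz /= => -[/eqP + /eqP + /eqP].
rewrite !subr_eq0 => /eqP e0 /eqP e1 /eqP e2.
have [b00|b00] := eqVneq b0 0; last first.
  have a0b : a0 != 0.
    apply/eqP => a00; apply: ha; move: e1 e2; rewrite a00 !mul0r => /eqP + /esym/eqP.
    by rewrite !mulf_eq0 (negbTE b00) !orbF => /eqP -> /eqP ->.
  exists (a0 / b0); split; first by rewrite mulf_neq0 ?invr_eq0.
  rewrite /scale3 /ptx /pty /ptz /= divfK //.
  by rewrite mulrAC e2 mulfK // mulrAC -e1 mulfK.
have [b10|b10] := eqVneq b1 0; last first.
  have a0b : a1 != 0.
    apply/eqP => a00; apply: ha; move: e0 e2; rewrite a00 !mul0r => /esym/eqP + /eqP.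
    by rewrite !mulf_eq0 (negbTE b10) !orbF => /eqP -> /eqP ->.
  exists (a1 / b1); split; first by rewrite mulf_neq0 ?invr_eq0.
  rewrite /scale3 /ptx /pty /ptz /= divfK //.
  by rewrite mulrAC -e2 mulfK // mulrAC e0 mulfK.
have b20 : b2 != 0 by apply/eqP => b20; apply: hb; rewrite b00 b10 b20.
have a0b : a2 != 0.
  apply/eqP => a00; apply: ha; move: e0 e1; rewrite a00 !mul0r => /eqP + /esym/eqP.
  by rewrite !mulf_eq0 (negbTE b20) !orbF => /eqP -> /eqP ->.
exists (a2 / b2); split; first by rewrite mulf_neq0 ?invr_eq0.
rewrite /scale3 /ptx /pty /ptz /= divfK //.
by rewrite mulrAC e1 mulfK // mulrAC -e0 mulfK.
Qed.

Lemma cross_cross a b p : cross (cross a b) p =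
  (ptx b * dot a p - ptx a * dot b p, pty b * dot a p - pty a * dot b p,
   ptz b * dot a p - ptz a * dot b p).
Proof. by rewrite /cross /dot /ptx /pty /ptz /=; congr (_, _, _); ring. Qed.

Lemma meet_projeq a b p : nz3 a -> nz3 b -> ~ projeq a b -> nz3 p ->
  dot a p = 0 -> dot b p = 0 -> projeq p (cross a b).
Proof.
move=> ha hb nab hp ap bp; apply/projeq_sym/cross_eq0_projeq => //.
  by move=> /(cross_eq0_projeq ha hb).
by rewrite cross_cross ap bp !mulr0 subrr.
Qed.

Lemma projeq_trans a b c : projeq a b -> projeq b c -> projeq a c.
Proof.
move=> [l [l0 ->]] [k [k0 ->]]; exists (l * k); split; first exact: mulf_neq0.
by rewrite /scale3 /ptx /pty /ptz /= !mulrA.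
Qed.

Lemma meet_unique a b p q : nz3 a -> nz3 b -> ~ projeq a b -> nz3 p -> nz3 q ->
  dot a p = 0 -> dot b p = 0 -> dot a q = 0 -> dot b q = 0 -> projeq p q.
Proof.
move=> ha hb nab hp hq ap bp aq bq.
by apply: (projeq_trans (meet_projeq ha hb nab hp ap bp));
  apply/projeq_sym/meet_projeq.
Qed.

Lemma det_meet a b p xi : nz3 a -> nz3 b -> ~ projeq a b -> nz3 p ->
  dot a p = 0 -> dot b p = 0 -> dot xi p != 0 -> det a b xi != 0.
Proof.
move=> ha hb nab hp ap bp; have [l [l0 ->]] := meet_projeq ha hb nab hp ap bp.
rewrite dot_scale mulf_eq0 (negbTE l0) /= /det /dot.
by rewrite !(mulrC (ptx xi), mulrC (pty xi), mulrC (ptz xi)).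
Qed.

Lemma dot_crossl a b : dot (cross a b) a = 0.
Proof. by rewrite /dot /cross /ptx /pty /ptz /=; ring. Qed.
Lemma dot_crossr a b : dot (cross a b) b = 0.
Proof. by rewrite /dot /cross /ptx /pty /ptz /=; ring. Qed.

(** Two sides of a triangle meet only at their common vertex [p], so they are not concurrent with a
    line [xi] missing [p]. *)
Lemma det_cross_cross p q r xi :
  det (cross p q) (cross p r) xi = det p q r * dot xi p.
Proof. by rewrite /det /dot /cross /ptx /pty /ptz /=; ring. Qed.

Lemma det_cyc a b c : det a b c = det b c a.
Proof. by rewrite /det /dot /cross /ptx /pty /ptz /=; ring. Qed.

(* The point at which [a], [b], [c] take the values 1, 0, 0. *)
Definition dual a b c := scale3 (det a b c)^-1 (cross b c).

Lemma dot_dual a b c v : dot v (dual a b c) = det v b c / det a b c.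
Proof.
have -> : det v b c = dot v (cross b c).
  by rewrite /det /dot /cross /ptx /pty /ptz /=; ring.
by rewrite dot_scale mulrC.
Qed.

Variable R : polyring3 K.

Lemma cramer a b c : det a b c != 0 ->
  let u := dual a b c in let v := dual b c a in let w := dual c a b in
  [/\ X0 = cst (ptx u) * lin a + cst (ptx v) * lin b + cst (ptx w) * lin c :> R,
      X1 = cst (pty u) * lin a + cst (pty v) * lin b + cst (pty w) * lin c :> R &
      X2 = cst (ptz u) * lin a + cst (ptz v) * lin b + cst (ptz w) * lin c :> R].
Proof.
move=> d0; rewrite /dual -(det_cyc a b c) (det_cyc c a b) /=.
have dK (f : R) : f = cst (det a b c)^-1 * (cst (det a b c) * f).
  by rewrite mulrA -rmorphM mulVf // rmorph1 mul1r.
rewrite /scale3 /ptx /pty /ptz /= -/(ptx _) -/(pty _) -/(ptz _).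
split; rewrite 3!(rmorphM cst) -!mulrA -!mulrDr [LHS]dK; congr (_ * _);
  by rewrite /det /dot /lin /cross /ptx /pty /ptz /=; ring.
Qed.

Lemma tform_split a b c t f : det a b c != 0 -> tform t.+1 f ->
  exists f1 f2 f3, [/\ tform t f1, tform t f2, tform t f3 &
    f = lin a * f1 + lin b * f2 + lin c * f3 :> R].
Proof.
move=> /cramer[]; move: (dual a b c) (dual b c a) (dual c a b) => u v w e0 e1 e2.
move=> /tform_gen[f0 [f1 [f2 [h0 h1 h2 ->]]]].
exists (cst (ptx u) * f0 + cst (pty u) * f1 + cst (ptz u) * f2).
exists (cst (ptx v) * f0 + cst (pty v) * f1 + cst (ptz v) * f2).
exists (cst (ptx w) * f0 + cst (pty w) * f1 + cst (ptz w) * f2).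
split; try by do 2?[apply: tformD]; apply: tformCM.
by rewrite e0 e1 e2; ring.
Qed.

End Geometry.
Arguments dual {K}.

Section Multiplicity.
Variable K : fieldType.

Lemma prod_XsubC_exp_dvdp (us : seq K) m (g : {poly K}) : uniq us ->
  (forall u, u \in us -> ('X - u%:P) ^+ m %| g) ->
  (\prod_(u <- us) ('X - u%:P)) ^+ m %| g.
Proof.
elim: us => [|u us IH] /=; first by rewrite big_nil expr1n dvd1p.
move=> /andP[u_us us_uniq] hg; rewrite big_cons exprMn Gauss_dvdp.
  rewrite hg ?mem_head // IH // => v vus; apply: hg.
  by rewrite inE vus orbT.
by apply/coprimep_expl/coprimep_expr; rewrite coprimep_sym coprimep_XsubC root_prod_XsubC.
Qed.

Lemma vanish_of_multiplicities (us : seq K) m t (g : {poly K}) : uniq us ->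
  (forall u, u \in us -> ('X - u%:P) ^+ m %| g) ->
  (size g <= t.+1)%N -> (t < m * size us)%N -> g = 0.
Proof.
move=> us_uniq hg sg tm; apply/eqP; case: eqVneq => // g0.
have := dvdp_leq g0 (prod_XsubC_exp_dvdp us_uniq hg).
set h := _ ^+ m; have : (size h).-1 = (size us * m)%N by rewrite size_exp size_prod_XsubC.
move=> eh /leq_trans/(_ sg); rewrite -subn1 in eh.
by rewrite -[t.+1]add1n -leq_subLR eh leqNgt mulnC tm.
Qed.

End Multiplicity.

Section Bezout.
Variables (K : fieldType) (R : polyring3 K) (xi eta l : pt K).
Hypothesis d0 : det xi eta l != 0.
Implicit Types f g : R.

Local Notation pA := (dual xi eta l).
Local Notation pB := (dual eta l xi).

(* Restriction to the line [l], parametrised by pA + u pB with pB on xi. *)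
Definition res : {rmorphism R -> {poly K}} :=
  subst polyC ((ptx pA)%:P + (ptx pB)%:P * 'X) ((pty pA)%:P + (pty pB)%:P * 'X)
    ((ptz pA)%:P + (ptz pB)%:P * 'X).

Lemma res_lin a : res (lin a) = (dot a pA)%:P + (dot a pB)%:P * 'X.
Proof.
rewrite /res subst_lin; move: pA pB => u v; rewrite /= /dot !polyCD !polyCM.
by ring.
Qed.

Lemma size_res t f : tform t f -> (size (res f) <= t.+1)%N.
Proof.
have lin_size (u v : K) i : (size ((u%:P + v%:P * 'X) ^+ i)%R <= i.+1)%N.
  apply: (leq_trans (size_poly_exp_leq _ _)); rewrite ltnS.
  have : (size (u%:P + v%:P * 'X)%R <= 2)%N.
    rewrite addrC -cons_poly_def size_cons_poly; case: ifP => // _.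
    by rewrite ltnS size_polyC_leq1.
  by case: (size _) => [|[|[|]]] //= _; rewrite ?mul0n ?mul1n.
have mul_size (p q : {poly K}) m n : (size p <= m.+1)%N -> (size q <= n.+1)%N ->
    (size (p * q)%R <= (m + n).+1)%N.
  by move=> hp hq; apply: (leq_trans (size_polyMleq _ _)); lia.
move: f; apply: tform_ind => [|f g hf hg|c i j k <-].
- by rewrite rmorph0 size_poly0.
- by rewrite rmorphD; apply: (leq_trans (size_polyD _ _)); rewrite geq_max hf hg.
rewrite /mono3 3!(rmorphM res) 3!(rmorphXn res) /res substC substX0 substX1 substX2 /=.
apply: (mul_size); last exact: lin_size.
apply: (mul_size); last exact: lin_size.
rewrite -[i]add0n; apply: (mul_size); last by rewrite add0n; exact: lin_size.
exact: size_polyC_leq1.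
Qed.

(** Cramer's rule for [p] in the frame [xi], [eta], [l]; the third term drops out because [p] lies
    on [l]. With [xi] normalised to 1 at the point, the parameter is the quotient of [eta] by
    [xi]. *)
Lemma point_on_line p : dot l p = 0 -> dot xi p != 0 ->
  scale3 (dot xi p)^-1 p =
  (ptx pA + ptx pB * (dot eta p / dot xi p), pty pA + pty pB * (dot eta p / dot xi p),
   ptz pA + ptz pB * (dot eta p / dot xi p)).
Proof.
move=> lp xp.
have e x u v : det xi eta l * x = dot xi p * u + dot eta p * v ->
    (dot xi p)^-1 * x =
    (det xi eta l)^-1 * u + (det xi eta l)^-1 * v * (dot eta p / dot xi p).
  move=> h; have -> : x = (dot xi p * u + dot eta p * v) / det xi eta l.
    by rewrite -h mulrAC mulfV // mul1r.
  by field; rewrite d0 xp.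
rewrite /dual -(det_cyc xi eta l) /scale3 /=; congr (_, _, _); apply: e;
apply/eqP; rewrite -subr_eq0; apply/eqP.
- transitivity (dot l p * ptx (cross xi eta)); last by rewrite lp mul0r.
  by rewrite /det /dot /cross /ptx /pty /ptz /=; ring.
- transitivity (dot l p * pty (cross xi eta)); last by rewrite lp mul0r.
  by rewrite /det /dot /cross /ptx /pty /ptz /=; ring.
- transitivity (dot l p * ptz (cross xi eta)); last by rewrite lp mul0r.
  by rewrite /det /dot /cross /ptx /pty /ptz /=; ring.
Qed.

Lemma res_root p f : dot l p = 0 -> dot xi p != 0 -> ptI p f ->
  root (res f) (dot eta p / dot xi p).
Proof.
move=> lp xp hf; apply/eqP; rewrite -(hf (dot xi p)^-1) point_on_line //.
set w := _ / _; pose u : {rmorphism R -> K} := horner_eval w \o res.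
rewrite -[LHS]/(u f); apply: polyring3_rmorph_eq => [c|||]; rewrite /u /= /res /ev /horner_eval.
- by rewrite !substC hornerC.
- by rewrite !substX0 hornerD hornerM !hornerC hornerX.
- by rewrite !substX1 hornerD hornerM !hornerC hornerX.
- by rewrite !substX2 hornerD hornerM !hornerC hornerX.
Qed.

Lemma res_idealX p m f : dot l p = 0 -> dot xi p != 0 -> idealX (ptI p) m f ->
  ('X - (dot eta p / dot xi p)%:P) ^+ m %| res f.
Proof.
move=> lp xp [n [a [Ia ->]]]; rewrite rmorph_sum; elim/big_ind: _ => [|g h|j _].
- exact: dvdp0.
- exact: dvdp_add.
rewrite rmorph_prod -[in X in X %| _](card_ord m) -prodr_const.
elim/big_rec2: _ => // i g h _ hgh; rewrite dvdp_mul // dvdp_XsubCl.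
exact: res_root.
Qed.

(** [sec] drops the [lin l] terms of Cramer's formulas, so [f] and [sec f] agree modulo [lin l]. In
    the fraction field, [sec f] is [lin xi ^+ t] times the value of [res f] at [lin eta / lin xi],
    which is zero. *)
Lemma res_eq0_dvd t f : tform t f -> res f = 0 -> exists g, f = lin l * g.
Proof.
move=> hf rf; have [e0 e1 e2] := cramer R d0.
pose sec : {rmorphism R -> R} := subst cst
  (cst (ptx pA) * lin xi + cst (ptx pB) * lin eta)
  (cst (pty pA) * lin xi + cst (pty pB) * lin eta)
  (cst (ptz pA) * lin xi + cst (ptz pB) * lin eta).
have secE g : exists h, g = sec g + lin l * h.
  move: g; apply: polyring3_ind => [c||||g h [g' eg] [h' eh]|g h [g' eg] [h' eh]].
  - by exists 0; rewrite /sec substC mulr0 addr0.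
  - by exists (cst (ptx (dual l xi eta))); rewrite /sec substX0 [LHS]e0 [_ * lin l]mulrC.
  - by exists (cst (pty (dual l xi eta))); rewrite /sec substX1 [LHS]e1 [_ * lin l]mulrC.
  - by exists (cst (ptz (dual l xi eta))); rewrite /sec substX2 [LHS]e2 [_ * lin l]mulrC.
  - exists (g' + h'); rewrite {1}eg {1}eh rmorphD.
    by move: (sec g) (sec h) (lin l) => u v w; ring.
  - exists (g' * sec h + sec g * h' + lin l * g' * h'); rewrite {1}eg {1}eh rmorphM.
    by move: (sec g) (sec h) (lin l) => u v w; ring.
have [h fE] := secE f; exists h; rewrite {}fE; suff -> : sec f = 0 by rewrite add0r.
have x0 : lin xi != 0 :> R.
  apply/eqP => /(congr1 (ev pA)); rewrite rmorph0 ev_lin dot_dual mulfV // => /eqP.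
  by rewrite oner_eq0.
apply/eqP; rewrite -tofrac_eq0; apply/eqP.
pose phi : {rmorphism K -> {fraction R}} := @tofrac R \o cst.
pose w := tofrac (lin eta) / tofrac (lin xi) : {fraction R}.
pose u : {rmorphism R -> {fraction R}} := subst phi
  (tofrac (lin xi) * (phi (ptx pA) + phi (ptx pB) * w))
  (tofrac (lin xi) * (phi (pty pA) + phi (pty pB) * w))
  (tofrac (lin xi) * (phi (ptz pA) + phi (ptz pB) * w)).
pose v : {rmorphism R -> {fraction R}} := @tofrac R \o sec.
have wE y z : tofrac (cst y * lin xi + cst z * lin eta) =
    tofrac (lin xi) * (phi y + phi z * w).
  rewrite tofracD !tofracM mulrDr mulrC /w; congr (_ + _).
  by rewrite mulrCA [_ * (_ / _)]mulrC divfK // tofrac_eq0.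
have vu : v =1 u.
  apply: polyring3_rmorph_eq => [c|||]; rewrite /v /u /=.
  - by rewrite /sec !substC.
  - by rewrite /sec !substX0.
  - by rewrite /sec !substX1.
  - by rewrite /sec !substX2.
rewrite -[LHS]/(v f) vu /u (tform_scale _ _ _ _ _ hf).
pose hm : {rmorphism {poly K} -> {fraction R}} := horner_morph (fun y => mulrC w (phi y)).
pose z : {rmorphism R -> {fraction R}} := hm \o res.
have hmE y y' : hm (y%:P + y'%:P * 'X) = phi y + phi y' * w.
  by rewrite rmorphD rmorphM; congr (_ + _ * _);
   [exact: horner_morphC|exact: horner_morphC|exact: horner_morphX].
have -> : subst phi (phi (ptx pA) + phi (ptx pB) * w) (phi (pty pA) + phi (pty pB) * w)
   (phi (ptz pA) + phi (ptz pB) * w) f = z f.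
  apply: polyring3_rmorph_eq => [c|||]; rewrite /z /=.
  - by rewrite /res !substC; exact/esym/horner_morphC.
  - by rewrite /res !substX0 hmE.
  - by rewrite /res !substX1 hmE.
  - by rewrite /res !substX2 hmE.
by rewrite /z /= rf rmorph0 mulr0.
Qed.

End Bezout.

(** * Products of lines modulo a linear form *)

Section Spanning.
Variables (K : fieldType) (R : polyring3 K) (xi : pt K) (J : R -> Prop).
Hypotheses (JD : forall f g, J f -> J g -> J (f + g))
  (JM : forall f g, J g -> J (f * g)).
Implicit Types f g h : R.
Local Notation x := (@lin K R xi).

(* With [h] of degree [e]: the multiples of [h] of degree [e + d] lie in J + (x). *)
Definition splits h (e d : nat) : Prop := forall f, tform d f ->
  exists F G, [/\ h * f = F + x * G, tform (e + d) F & J F].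

Lemma splits_mem h e d : tform e h -> J h -> splits h e d.
Proof.
move=> he Jh f hf; exists (h * f), 0; rewrite mulr0 addr0.
by split=> //; [exact: tformM|rewrite mulrC; exact: JM].
Qed.

(** The lines [a], [b] and [xi] form a frame, so a form of positive degree is a combination of their
    equations; the part along [x] goes into [G]. *)
Lemma splits_two a b h e d : det a b xi != 0 ->
  splits (h * lin a) e.+1 d -> splits (h * lin b) e.+1 d -> splits h e d.+1.
Proof.
move=> d0 sa sb f hf; have [f1 [f2 [f3 [h1 h2 h3 ->]]]] := tform_split d0 hf.
have [F1 [G1 [e1 t1 J1]]] := sa _ h1; have [F2 [G2 [e2 t2 J2]]] := sb _ h2.
exists (F1 + F2), (G1 + G2 + h * f3); split.
- rewrite mulrDr mulrDr !(mulrA h (lin _)) e1 e2.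
  by move: x => y; ring.
- by rewrite -addSnnS; apply: tformD.
- exact: JD.
Qed.

(** As [q] is off [xi], subtracting a multiple of [x] from any linear form makes it vanish at
    [q]. *)
Lemma splits_point q h e d : dot xi q != 0 ->
  (forall l, dot l q = 0 -> splits (h * lin l) e.+1 d) -> splits h e d.+1.
Proof.
move=> xq sl f /tform_gen[f0 [f1 [f2 [h0 h1 h2 ->]]]].
have coord (v : pt K) : exists l, dot l q = 0 /\
    lin v = lin l + cst (dot v q / dot xi q) * x.
  set c := dot v q / dot xi q.
  exists (ptx v - c * ptx xi, pty v - c * pty xi, ptz v - c * ptz xi); split.
    transitivity (dot v q - c * dot xi q); last by rewrite divfK // subrr.
    by rewrite /dot /ptx /pty /ptz /=; ring.
  rewrite /lin /ptx /pty /ptz /= -/(ptx _) -/(pty _) -/(ptz _).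
  by move: (ptx v) (pty v) (ptz v) (ptx xi) (pty xi) (ptz xi) c => *; ring.
have step (v : pt K) g : tform d g ->
    exists F G, [/\ h * (lin v * g) = F + x * G, tform (e + d.+1) F & J F].
  move=> hg; have [l [lq ->]] := coord v; have [F [G [eF tF JF]]] := sl l lq g hg.
  exists F, (G + cst (dot v q / dot xi q) * (h * g)); rewrite -addSnnS; split=> //.
  by rewrite mulrDl mulrDr mulrA eF; move: (cst _) x => c y; ring.
have linX : [/\ lin (1, 0, 0) = X0 :> R, lin (0, 1, 0) = X1 :> R &
    lin (0, 0, 1) = X2 :> R].
  by split; rewrite /lin /ptx /pty /ptz /= rmorph0 rmorph1; ring.
have [E0 E1 E2] := linX; rewrite -E0 -E1 -E2.
have [F0 [G0 [e0 t0 J0]]] := step (1, 0, 0) _ h0.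
have [F1 [G1 [e1 t1 J1]]] := step (0, 1, 0) _ h1.
have [F2 [G2 [e2 t2 J2]]] := step (0, 0, 1) _ h2.
exists (F0 + F1 + F2), (G0 + G1 + G2); split; try by do 2?[apply: tformD].
  by rewrite !mulrDr e0 e1 e2; move: x => y; ring.
by apply: (JD) => //; apply: (JD).
Qed.

(** Iterates [splits_point], with one line through each listed point. A point may be repeated, to
    impose a higher multiplicity there. *)
Lemma splits_points (ps : seq (pt K)) h e : tform e h ->
  (forall p, p \in ps -> dot xi p != 0) ->
  (forall ls, all2 (fun l p => dot l p == 0) ls ps ->
     J (h * \prod_(l <- ls) lin l)) ->
  splits h e (size ps).
Proof.
elim: ps h e => [|p ps IH] h e he xps hJ /=.
  by apply: splits_mem => //; have := hJ [::] isT; rewrite big_nil mulr1.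
apply: (@splits_point p) => [|l lp]; first by apply: xps; rewrite mem_head.
apply: IH => [|q qps|ls hls].
- by rewrite -addn1; apply: tformM => //; exact: tform_lin.
- by apply: xps; rewrite inE qps orbT.
by have := hJ (l :: ls); rewrite big_cons mulrA /= lp eqxx; apply.
Qed.

End Spanning.

(** * The residual ideal fills its critical degree modulo the form [lin xi] *)

Section LinesAndPoints.
Variables (K : fieldType) (R : polyring3 K) (xi : pt K).
Hypothesis K_infinite : forall N, exists rs : seq K, uniq rs /\ size rs = N.
Variables (s N : nat) (M Q : 'I_s -> pt K) (X : pt K -> Prop).
Hypothesis xi_meet : forall j k, j != k -> det (M j) (M k) xi != 0.
Hypothesis xi_Q : forall k, dot xi (Q k) != 0.
Hypothesis MQ : forall k, dot (M k) (Q k) = 0.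
Hypothesis Q_triangle : forall k, exists l l',
  [/\ l != k, l' != k & det (Q k) (Q l) (Q l') != 0].
Hypothesis X_points : forall p, X p ->
  dot xi p != 0 /\ ((exists j k, [/\ j != k, dot (M j) p = 0 & dot (M k) p = 0]) \/
                    exists k, p = Q k).
Implicit Types (f g h : R) (a : 'I_s -> nat).

Definition allM : R := \prod_j lin (M j).
(* The residual, with respect to the lines [M], of the ideal of the fat points
   of multiplicity N + 2. *)
Definition fatJ f := forall p, X p -> ord xi p N.+2 (allM * f).
Definition powM a : R := \prod_j lin (M j) ^+ a j.

Lemma fatJ_D f g : fatJ f -> fatJ g -> fatJ (f + g).
Proof. by move=> hf hg p Xp; rewrite mulrDr; apply: ordD; [apply: hf|apply: hg]. Qed.

Lemma fatJ_M f g : fatJ g -> fatJ (f * g).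
Proof. by move=> hg p Xp; rewrite mulrCA; exact: (ord_mull _ (hg p Xp)). Qed.

Lemma ord_allM_powM p a : dot xi p != 0 ->
  ord xi p (\sum_j (dot (M j) p == 0%R) * (a j).+1) (allM * powM a).
Proof.
move=> xp; rewrite /allM /powM -big_split; apply: ord_prod => j _ /=.
case: eqP => [Mp|_]; last exact: ord0f.
by rewrite -exprS; apply: ordX; apply: ord_lin => //.
Qed.

Lemma ord_lines p (ls ps : seq (pt K)) : dot xi p != 0 ->
  all2 (fun l q => dot l q == 0) ls ps ->
  ord xi p (count_mem p ps) (\prod_(l <- ls) lin l : R).
Proof.
move=> xp; elim: ls ps => [|l ls IH] [|q ps] //= => /andP[lq /IH hls].
rewrite big_cons; apply: ordM => //.
have [qp|_] := eqVneq q p; last exact: ord0f.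
by apply: ord_lin => //; rewrite -qp; apply/eqP.
Qed.

Lemma tform_powM a : tform (\sum_j a j) (powM a).
Proof.
apply: tform_prod => j _; rewrite -[a j]mul1n; elim: (a j) => [|n IH].
  exact: tform1.
by rewrite exprS mulnS; apply: tformM IH; exact: tform_lin.
Qed.

(** The remaining degree is spent on a line joining [Q k] to some [Q i], a line through each of the
    s - 2 other points [Q j], and N - a_k lines through [Q k]. Two choices of [i] not collinear with
    [Q k] give the two lines for [splits_two]. *)
Lemma splits_powM_last k a : (forall j, j != k -> a j = N) -> (a k <= N)%N ->
  splits xi fatJ (powM a) (\sum_j a j) (N + s - 1 - a k).
Proof.
move=> aN akN; have [l [l' [lk l'k d0]]] := Q_triangle k.
pose ps l := [seq Q j | j <- enum 'I_s & (j != k) && (j != l)] ++ nseq (N - a k) (Q k).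
have size_ps i : i != k -> (size (ps i)).+1 = (N + s - 1 - a k)%N.
  move=> ik; rewrite size_cat size_nseq size_map size_filter.
  have := count_predC (fun j => (j != k) && (j != i)) (enum 'I_s).
  rewrite size_enum_ord; set c := count _ _; set c' := count _ _.
  have : c' = 2.
    transitivity #|[set k; i]|; last by rewrite cards2 eq_sym ik.
    rewrite /c' -sum1_count big_enum_cond /= sum1dep_card; apply: eq_card => j.
    by rewrite !inE negb_and !negbK.
  by move=> -> hs; lia.
have key i : i != k -> forall ls, all2 (fun l q => dot l q == 0) ls (ps i) ->
    fatJ (powM a * lin (cross (Q k) (Q i)) * \prod_(l <- ls) lin l).
  move=> ik ls hls p Xp; have [xp pX] := X_points Xp.
  rewrite -mulrA mulrA.
  have o1 := @ord_allM_powM p a xp; have o2 := ord_lines xp hls.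
  (* Where two lines [M] meet, one of them is not [M k] and has exponent N, so the order is at least
     (N + 1) + 1. At [Q k] the orders a_k + 1, 1 and N - a_k add up to N + 2. At another [Q j] the
     line [M j] gives N + 1, and the joining line or a listed line gives one more. *)
  case: pX => [[j [j' [jj' Mj Mj']]]|[j pQ]].
    apply: (@ord_le _ _ _ _ _ (_ + 0)); last exact: ordM o1 (@ord0f _ R _ _ _).
    rewrite addn0 (bigD1 j) //= (bigD1 j') 1?eq_sym //= Mj Mj' eqxx !mul1n.
    have : (N <= a j + a j')%N.
      have [jk|/eqP jk] := eqVneq j k; last by rewrite (aN j) ?leq_addr //; exact/eqP.
      by rewrite (aN j') ?leq_addl // -jk eq_sym.
    lia.
  have lej : ((a j).+1 <= \sum_j (dot (M j) p == 0%R) * (a j).+1)%N.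
    by rewrite (bigD1 j) //= pQ MQ eqxx mul1n leq_addr.
  have [jk|jk] := eqVneq j k.
    have o3 : ord xi p 1 (lin (cross (Q k) (Q i)) : R).
      by apply: ord_lin => //; rewrite pQ jk dot_crossl.
    apply: ord_le (ordM o1 (ordM o3 o2)).
    have : (N - a k <= count_mem p (ps i))%N.
      by rewrite count_cat count_nseq pQ jk /= eqxx mul1n leq_addl.
    by move: lej; rewrite jk; lia.
  have [ji|ji] := eqVneq j i.
    have o3 : ord xi p 1 (lin (cross (Q k) (Q i)) : R).
      by apply: ord_lin => //; rewrite pQ ji dot_crossr.
    apply: ord_le (ordM o1 (ordM o3 (@ord0f _ R _ _ _))).
    by move: lej; rewrite aN //; lia.
  apply: ord_le (ordM o1 (ordM (@ord0f _ R _ _ _) o2)).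
  have : (0 < count_mem p (ps i))%N.
    rewrite -has_count has_pred1 mem_cat pQ map_f //.
    by rewrite mem_filter jk ji mem_enum.
  by move: lej; rewrite aN //; lia.
have one i : i != k ->
    splits xi fatJ (powM a * lin (cross (Q k) (Q i))) (\sum_j a j).+1 (size (ps i)).
  move=> ik; apply: splits_points; last exact: key.
  - exact: fatJ_D.
  - exact: fatJ_M.
  - by rewrite -addn1; apply: tformM; [exact: tform_powM|exact: tform_lin].
  move=> p; rewrite mem_cat => /orP[/mapP[j _ ->] //|].
  by rewrite mem_nseq => /andP[_ /eqP ->].
have := one l lk; have := one l' l'k.
have := size_ps l lk; have := size_ps l' l'k; rewrite -(size_ps l lk) => -[->] _ h' h.
apply: splits_two h h' => //; first exact: fatJ_D.
by rewrite det_cross_cross mulf_neq0.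
Qed.

(** While two exponents are below N, [splits_two] with the corresponding lines raises either of
    them. The degree cannot run out first, because N s < (N + 1) s - 1; so all exponents but one
    reach N and [splits_powM_last] applies. *)
Lemma splits_powM a d : (forall j, a j <= N)%N -> (1 < s)%N ->
  (\sum_j a j + d = N.+1 * s - 1)%N -> splits xi fatJ (powM a) (\sum_j a j) d.
Proof.
move=> + s_gt1; elim: d a => [|d IH] a aN e.
  have : (\sum_j a j <= \sum_(j < s) N)%N by apply: leq_sum.
  by rewrite sum_nat_const card_ord => h; exfalso; nia.
have [/existsP[j /existsP[k /and3P[jk aj ak]]]|] :=
    boolP [exists j, exists k, [&& j != k, a j < N & a k < N]%N].
  have step i : (a i < N)%N ->
      splits xi fatJ (powM a * lin (M i)) (\sum_j a j).+1 d.
    move=> ai; pose b j := (a j + (j == i))%N.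
    have eb : (\sum_j b j = (\sum_j a j).+1)%N.
      rewrite big_split /= -[RHS]addn1; congr addn.
      by rewrite (bigD1 i) //= eqxx big1 // => l /negbTE ->.
    have -> : powM a * lin (M i) = powM b.
      rewrite /powM (bigD1 i) //= [RHS](bigD1 i) //= /b eqxx addn1 exprSr.
      rewrite mulrAC; congr (_ * _); apply: eq_bigr => l /negbTE li.
      by rewrite li addn0.
    rewrite -eb; apply: IH; last by rewrite eb addSnnS.
    by move=> l; rewrite /b; case: eqP => [->|_]; rewrite ?addn1 // addn0.
  apply: splits_two (step j aj) (step k ak); [exact: fatJ_D|exact: xi_meet].
rewrite negb_exists => /forallP h.
have [k hk] : exists k, forall j, j != k -> a j = N.
  have [k ak|all_full] := pickP (fun k => a k < N)%N.
    exists k => j jk; apply/eqP; rewrite eqn_leq aN leqNgt; apply/negP => aj.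
    by have /existsP[] := h j; exists k; rewrite jk aj ak.
  exists (Ordinal (ltnW s_gt1)) => j _.
  by apply/eqP; rewrite eqn_leq aN leqNgt all_full.
have -> : d.+1 = (N + s - 1 - a k)%N.
  move: e; rewrite (bigD1 k) //= (eq_bigr (fun=> N)); last exact: hk.
  rewrite sum_nat_const cardC1 card_ord; have := aN k; move: (a k) => ak akN.
  case: s s_gt1 => // s' _ /=; nia.
exact: splits_powM_last.
Qed.

Theorem fatJ_complement f : (1 < s)%N -> tform (N.+1 * s - 1) f ->
  exists F G, [/\ f = F + lin xi * G, tform (N.+1 * s - 1) F & fatJ F].
Proof.
move=> s_gt1 hf.
have := @splits_powM (fun=> 0%N) (N.+1 * s - 1) (fun=> isT) s_gt1.
rewrite big1 // add0n => /(_ erefl) h; have [F [G [e t j]]] := h f hf.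
exists F, G; split=> //; rewrite -e /powM big1 ?mul1r // => i _.
Qed.

End LinesAndPoints.

(** * Splitting off the lines and comparing two consecutive degrees *)

Section HilbertDifference.
Variables (K : fieldType) (R : polyring3 K) (xi : pt K).
Hypothesis K_infinite : forall N, exists rs : seq K, uniq rs /\ size rs = N.
Variables (s N : nat) (M Q : 'I_s -> pt K) (X : pt K -> Prop).
Hypothesis s_gt1 : (1 < s)%N.
Hypothesis xi_z : ptz xi = 1.
Hypothesis xi_meet : forall j k, j != k -> det (M j) (M k) xi != 0.
Hypothesis xi_Q : forall k, dot xi (Q k) != 0.
Hypothesis MQ : forall k, dot (M k) (Q k) = 0.
Hypothesis Q_triangle : forall k, exists l l',
  [/\ l != k, l' != k & det (Q k) (Q l) (Q l') != 0].
Hypothesis X_points : forall p, X p ->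
  dot xi p != 0 /\ ((exists j k, [/\ j != k, dot (M j) p = 0 & dot (M k) p = 0]) \/
                    exists k, p = Q k).
Hypothesis M_points : forall k, exists p : 'I_s -> pt K,
  [/\ forall i, X (p i), forall i, dot (M k) (p i) = 0 &
      forall i j, i != j -> ~ projeq (p i) (p j)].
Implicit Types (f g h : R).

Local Notation fatJ := (@fatJ K R xi s N M X).
Local Notation allM := (@allM K R s M).

Definition fat m f : Prop := forall p, X p -> idealX (ptI p) m f.

Lemma other_index (k : 'I_s) : exists j : 'I_s, j != k.
Proof.
have [k0|k0] := eqVneq (k : nat) 0%N.
  by exists (Ordinal s_gt1); rewrite -val_eqE /= k0.
by exists (Ordinal (ltnW s_gt1)); rewrite -val_eqE /= eq_sym.
Qed.

Lemma det_frame j k : j != k -> det xi (M j) (M k) != 0.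
Proof. by move=> jk; rewrite det_cyc xi_meet. Qed.

(** The restriction to [M k] has degree at most t but vanishes to order m at the parameters of s
    points. These are distinct because the parameter determines the point on the line. *)
Lemma res_fat_eq0 m t f j k : j != k -> tform t f -> (t < m * s)%N -> fat m f ->
  res R xi (M j) (M k) f = 0.
Proof.
move=> jk tf tms hf; have d0 := det_frame jk.
have [p [Xp Mp pp]] := M_points k.
have xp i : dot xi (p i) != 0 by have [] := X_points (Xp i).
pose u i := dot (M j) (p i) / dot xi (p i).
have u_inj : injective u.
  move=> i i' uii; apply/eqP; case: eqVneq => // ii'; case: (pp _ _ ii').
  have e : scale3 (dot xi (p i))^-1 (p i) = scale3 (dot xi (p i'))^-1 (p i').
    by rewrite !(point_on_line d0) // -/(u i) -/(u i') uii.
  exists (dot xi (p i) / dot xi (p i')); split.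
    by rewrite mulf_neq0 ?invr_eq0.
  transitivity (scale3 (dot xi (p i)) (scale3 (dot xi (p i))^-1 (p i))).
    by rewrite -{1}[dot xi (p i)]invrK scale3K ?invr_eq0.
  by rewrite e {1 3}/scale3; congr (_, _, _); rewrite mulrA.
apply: (@vanish_of_multiplicities _ (map u (enum 'I_s)) m t).
- by rewrite map_inj_uniq // enum_uniq.
- by move=> _ /mapP[i _ ->]; apply: res_idealX => //; apply: hf.
- exact: size_res.
- by rewrite size_map size_enum_ord.
Qed.

Lemma lin_M_neq0 k : lin (M k) != 0 :> R.
Proof.
have [j jk] := other_index k; apply/eqP => /(congr1 (ev (cross (M j) xi))).
rewrite ev_lin rmorph0 => e; case/eqP: (xi_meet jk).
transitivity (- dot (M k) (cross (M j) xi)); last by rewrite e oppr0.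
by rewrite /det /dot /cross /ptx /pty /ptz /=; ring.
Qed.

Lemma tform_prod_lines (r : seq 'I_s) : tform (size r) (\prod_(k <- r) lin (M k) : R).
Proof.
rewrite -sum1_size; apply: tform_prod => k _; exact: tform_lin.
Qed.

Lemma prod_lines_neq0 (r : seq 'I_s) : \prod_(k <- r) lin (M k) != 0 :> R.
Proof. by rewrite prodf_seq_neq0; apply/allP => k _; rewrite lin_M_neq0. Qed.

(** Lines are split off one at a time. What is known to vanish on the next line is [f], not the
    quotient [g]; but the lines already removed restrict to nonzero polynomials, so [g] restricts to
    zero. *)
Lemma prod_lines_dvd m t f (r : seq 'I_s) : uniq r -> (size r <= t)%N -> tform t f ->
  (t < m * s)%N -> fat m f ->
  exists2 g, tform (t - size r) g & f = \prod_(k <- r) lin (M k) * g.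
Proof.
elim: r => [|k r IH] /=; first by exists f; rewrite ?subn0 ?big_nil ?mul1r.
move=> /andP[kr r_uniq] rt tf tms hf.
have [g tg fE] := IH r_uniq (ltnW rt) tf tms hf.
have [j jk] := other_index k; have d0 := det_frame jk.
have := res_fat_eq0 jk tf tms hf; rewrite fE rmorphM rmorph_prod => /eqP.
rewrite mulf_eq0 prodf_seq_eq0 => /orP[/hasP[l lr /=]|/eqP rg].
  have lk : l != k by apply: contraNneq kr => <-.
  (* The coefficient of the parameter in the restriction of [M l] is
     [det (M l) (M k) xi / det (M j) (M k) xi], which is nonzero. *)
  rewrite res_lin => /eqP /(congr1 (fun q : {poly K} => q`_1)) /eqP.
  rewrite coefD coefC coefMX coefC coef0 add0r /= dot_dual mulf_eq0 invr_eq0.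
  by rewrite (negbTE (xi_meet lk)) (negbTE (xi_meet jk)).
have [h gE] := res_eq0_dvd d0 tg rg; exists h.
  apply: (@tform_cancel _ _ (size r).+1 _ (\prod_(k0 <- k :: r) lin (M k0)) h).
  - exact: prod_lines_neq0.
  - exact: (tform_prod_lines (k :: r)).
  by rewrite subnKC // big_cons -mulrA mulrCA -gE -fE.
by rewrite big_cons gE -mulrA mulrCA.
Qed.

Lemma fatJE g : fatJ g <-> fat N.+2 (allM * g).
Proof.
by split=> h p Xp; have [xp _] := X_points Xp; apply/(idealX_ord K_infinite xp); apply: h.
Qed.

Lemma fat_divM t f : (s <= t)%N -> (t < N.+2 * s)%N ->
  (tform t f /\ fat N.+2 f) <->
  exists2 g, tform (t - s) g /\ fatJ g & f = allM * g.
Proof.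
move=> st ts; split=> [[tf ff]|[g [tg Jg] ->]].
  have := @prod_lines_dvd N.+2 t f (enum 'I_s) (enum_uniq _).
  rewrite size_enum_ord => /(_ st tf ts ff)[g tg fE].
  have eM : \prod_(k <- enum 'I_s) lin (M k) = allM by rewrite /allM big_enum.
  by rewrite eM in fE; exists g => //; split=> //; rewrite fatJE -fE.
split; last by rewrite -fatJE.
rewrite -(subnKC st); apply: tformM => //.
by have := tform_prod_lines (enum 'I_s); rewrite size_enum_ord big_enum.
Qed.

(** With m = N + 2, the residual degrees are t' + 1 and t'. The whole ring gains m s dimensions
    between degrees m s - 2 and m s - 1, and the ideal gains t' + 2 = (N + 1) s, which leaves s. *)
Theorem hilbert_difference : exists r1 b1 r2 b2 : nat,
  [/\ spans_dim (@tform K R (N.+2 * s - 1)) r1,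
      spans_dim (fun f : R => tform (N.+2 * s - 1) f /\ fat N.+2 f) b1,
      spans_dim (@tform K R (N.+2 * s - 2)) r2,
      spans_dim (fun f : R => tform (N.+2 * s - 2) f /\ fat N.+2 f) b2 &
      (r1 + b2 = r2 + b1 + s)%N].
Proof.
pose t' := (N.+1 * s - 2)%N.
have et' : (t'.+1 = N.+1 * s - 1)%N by rewrite /t'; nia.
have e2 : (N.+2 * s - 2 - s = t')%N by rewrite /t'; nia.
have e1 : (N.+2 * s - 1 - s = t'.+1)%N by rewrite et'; nia.
have et : ((N.+2 * s - 2).+1 = N.+2 * s - 1)%N by nia.
have JD : forall f g, fatJ f -> fatJ g -> fatJ (f + g) by exact: fatJ_D.
have JM : forall f g, fatJ g -> fatJ (f * g) by exact: fatJ_M.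
have Jx g : fatJ (lin xi * g) <-> fatJ g.
  split=> [h p Xp|]; last exact: JM.
  have [xp _] := X_points Xp; apply: (ord_xi xp).
  by rewrite mulrCA; exact: h.
have [r2 hr2] := @spans_dim_tform K R xi xi_z (N.+2 * s - 2).
have hr1 := spans_dim_tform_succ xi_z hr2.
have [n' hn'] := @spans_dim_tform K R xi xi_z t'.
have [u hu] : exists u, spans_dim (fun f : R => tform t' f /\ fatJ f) u.
  apply: (spans_dim_sub hn') => [f []//||f g [f1 f2] [g1 g2]|c f [f1 f2]].
  - split; first exact: tform0.
    by move=> p _ i _; rewrite mulr0 rmorph0 coef0.
  - by split; [exact: tformD|exact: JD].
  - by split; [exact: tformCM|exact: JM].
have hu1 : spans_dim (fun f : R => tform t'.+1 f /\ fatJ f) (u + t'.+2).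
  apply: (spans_dim_succ xi_z) hu => // [c f|f hf]; first exact: JM.
  by have := @fatJ_complement K R xi K_infinite s N M Q X; rewrite et'; apply; rewrite -?et'.
have M0 : allM != 0 by have := prod_lines_neq0 (enum 'I_s); rewrite big_enum.
exists (r2 + (N.+2 * s - 2).+2)%N, (u + t'.+2)%N, r2, u; split.
- by rewrite -et.
- apply: (spans_dim_mull M0 hu1) => f; rewrite -e1; apply: fat_divM; nia.
- exact: hr2.
- apply: (spans_dim_mull M0 hu) => f; rewrite -e2; apply: fat_divM; nia.
rewrite /t'; nia.
Qed.

End HilbertDifference.

(** * Incidences in a triangular configuration *)

Section Counting.
Local Open Scope nat_scope.
Variables (T : finType) (s : nat) (X : {set T}) (A : 'I_s -> {set T}).
Hypotheses (A_sub : forall k, A k \subset X) (A_card : forall k, #|A k| = s)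
  (A_meet : forall k l, k != l -> #|A k :&: A l| <= 1)
  (X_card : 2 * #|X| = s * s.+1).
Definition mult (p : T) := #|[set k | p \in A k]|.

Lemma sum_mult (B : {set T}) : \sum_(p in B) mult p = \sum_k #|A k :&: B|.
Proof.
under eq_bigr do rewrite /mult cardsE -sum1_card.
rewrite (exchange_big_dep xpredT) //=; apply: eq_bigr => k _.
by rewrite -sum1_card; apply: eq_bigl => p; rewrite !inE andbC.
Qed.

(** Both sides count the triples (p, k, l) with p in [A k] and in [A l]. *)
Lemma sum_mult_sq : \sum_(p in X) mult p ^ 2 = \sum_k \sum_l #|A k :&: A l|.
Proof.
transitivity (\sum_(p in X) \sum_(k | p \in A k) mult p).
  by apply: eq_bigr => p _; rewrite sum_nat_const /mult cardsE -mulnn.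
rewrite (exchange_big_dep xpredT) //=; apply: eq_bigr => k _.
transitivity (\sum_(p in A k) mult p).
  apply: eq_bigl => p; case: (boolP (p \in A k)) => [pA|]; rewrite ?andbF //.
  by rewrite (subsetP (A_sub k)).
by rewrite sum_mult; apply: eq_bigr => l _; rewrite setIC.
Qed.

(* (mult p - 1) (mult p - 2) >= 0, and the sum of these products is at most 0. *)
Lemma mult_and_meet : (forall p, p \in X -> 0 < mult p <= 2) /\
  (forall k l, k != l -> #|A k :&: A l| = 1).
Proof.
(* [e p] is (mult p - 1)(mult p - 2), where the truncated subtraction is exact; [d k l] is the
   number of meeting points missing. *)
pose e p := mult p ^ 2 + 2 - 3 * mult p.
have eE p : e p + 3 * mult p = mult p ^ 2 + 2.
  rewrite /e subnK // -mulnn; case: (mult p) => [|[|n]] //; nia.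
pose d k l := 1 - #|A k :&: A l|.
have dE k l : k != l -> #|A k :&: A l| + d k l = 1.
  by move=> /A_meet; rewrite /d; lia.
have sum1 : \sum_(p in X) mult p = s * s.
  rewrite sum_mult; under eq_bigr do rewrite (setIidPl (A_sub _)) A_card.
  by rewrite sum_nat_const card_ord.
have sumk k : \sum_l #|A k :&: A l| + \sum_(l | l != k) d k l = s + s.-1.
  rewrite (bigD1 k) //= setIid A_card -addnA -big_split /=.
  rewrite (eq_bigr (fun=> 1)) => [|l lk]; last by rewrite dE // eq_sym.
  by rewrite sum_nat_const cardC1 card_ord muln1.
have sum2 : \sum_k \sum_l #|A k :&: A l| + \sum_k \sum_(l | l != k) d k l
    = s * (s + s.-1).
  by rewrite -big_split /= (eq_bigr _ (fun k _ => sumk k)) sum_nat_const card_ord.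
have sume : \sum_(p in X) e p + 3 * (s * s) = \sum_(p in X) mult p ^ 2 + #|X| * 2.
  rewrite -sum1 big_distrr /= -big_split /= (eq_bigr _ (fun p _ => eE p)).
  by rewrite big_split sum_nat_const.
(* The sum of the squares is s (2 s - 1) minus the total of [d], and twice the number of points is
   s^2 + s; the two totals thus add up to (2 s^2 - s) + (s^2 + s) - 3 s^2 = 0. *)
have ED : \sum_(p in X) e p + \sum_k \sum_(l | l != k) d k l == 0.
  have ss : s * s.-1 + s = s * s.
    by rewrite addnC -mulnS; case: (posnP s) => [->|/prednK ->].
  move: X_card sum2 sume; rewrite sum_mult_sq mulnS mulnDr => h1 h2 h3.
  by apply/eqP; lia.
move: ED; rewrite addn_eq0 !sum_nat_eq0 => /andP[/forallP e0 /forallP d0].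
split=> [p pX|k l kl].
  have /implyP/(_ pX)/eqP ep := e0 p; have := eE p; rewrite ep -mulnn.
  by case: (mult p) => [|[|[|n]]] //; nia.
have := d0 k; rewrite /= sum_nat_eq0 => /forallP/(_ l)/implyP.
by rewrite eq_sym kl => /(_ isT)/eqP dl; have := dE k l kl; rewrite dl addn0.
Qed.

(** Over [A k] the numbers 2 - mult p, each 0 or 1, sum to 2 s - (s + (s - 1)) = 1. *)
Lemma simple_point k : exists q, [/\ q \in A k, mult q = 1 &
  forall p, p \in A k -> mult p = 1 -> p = q].
Proof.
have [m12 meet] := mult_and_meet.
have m12' p : p \in A k -> 0 < mult p <= 2.
  by move=> pA; apply: m12; apply: subsetP (A_sub k) _ pA.
have sumA : \sum_(p in A k) (2 - mult p) = 1.
  have : \sum_(p in A k) (2 - mult p) + \sum_(p in A k) mult p = s * 2.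
    rewrite -big_split /= (eq_bigr (fun=> 2)) => [|p /m12']; last by lia.
    by rewrite sum_nat_const A_card.
  have -> : \sum_(p in A k) mult p = s + s.-1.
    rewrite sum_mult (bigD1 k) //= setIid A_card.
    rewrite (eq_bigr (fun=> 1)) => [|l lk]; last by rewrite meet.
    by rewrite sum_nat_const cardC1 card_ord muln1.
  by have := ltn_ord k; lia.
have [q /andP[qA q1]|none] := pickP (fun p => (p \in A k) && (mult p == 1)).
  exists q; split=> //; first exact/eqP.
  move=> p pA p1; apply/eqP; apply: contraTT isT => pq.
  move: sumA; rewrite (bigD1 q) //= (bigD1 p) /= ?pA ?pq // (eqP q1) p1.
  by lia.
move: sumA; rewrite big1 // => p pA; have := none p; rewrite pA /=.
by have := m12' p pA; case: (mult p) => [|[|[|]]].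
Qed.

End Counting.

Lemma card_triangle s : (2 * #|[set ij : 'I_s * 'I_s | (ij.2 <= ij.1)%N]| = s * s.+1)%N.
Proof.
rewrite cardsE -sum1_card.
rewrite -(pair_big_dep xpredT (fun i j : 'I_s => j <= i)%N (fun _ _ => 1%N)) /=.
have -> : (\sum_(i < s) \sum_(j < s | (j <= i)%N) 1 = \sum_(i < s) i.+1)%N.
  apply: eq_bigr => i _.
  rewrite (eq_bigl (fun j : 'I_s => j < i.+1)%N) // (big_ord_narrow (ltn_ord i)).
  by rewrite sum1_card card_ord.
elim: s => [|s IH]; first by rewrite big_ord0.
by rewrite big_ord_recr /= mulnDr IH; lia.
Qed.

(** * The nested encoding of the polynomial ring *)

Section Coefficients.
Variables (K : fieldType) (R : polyring3 K) (coef : R -> nat -> nat -> nat -> K).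
Implicit Types f g : R.
Hypothesis coef_add : forall f g i j k, coef (f + g) i j k = coef f i j k + coef g i j k.
Hypothesis coef_mono3 : forall c i j k i' j' k',
  coef (mono3 R c i j k) i' j' k' = c *+ [&& i' == i, j' == j & k' == k].
Hypothesis mono3_ind : forall T : R -> Prop, T 0 ->
  (forall f g, T f -> T g -> T (f + g)) ->
  forall f, (forall i j k, coef f i j k != 0 -> T (mono3 R (coef f i j k) i j k)) ->
  T f.

Lemma coef_zero i j k : coef 0 i j k = 0.
Proof. by apply: (addrI (coef 0 i j k)); rewrite -coef_add !addr0. Qed.

Lemma coef_theta f r i j k :
  coef (theta R f)`_r i j k = coef f i j k *+ (i + j + k == r)%N.
Proof.
pose T g := coef (theta R g)`_r i j k = coef g i j k *+ (i + j + k == r)%N.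
rewrite -/(T f); apply: (mono3_ind) => [|g h eg eh|ii jj kk _]; rewrite /T.
- by rewrite rmorph0 coef0 coef_zero mul0rn.
- by rewrite rmorphD coefD !coef_add mulrnDl eg eh.
rewrite theta_mono; set c := (X in mono3 _ X); move: c => c.
rewrite coefMXn coef_mono3.
case: (boolP [&& _, _ & _]) => [/and3P[/eqP-> /eqP-> /eqP->]|/negbTE hn].
  case: ltngtP => hr; rewrite ?mulr0n ?coef_zero //.
    by rewrite coefC subn_eq0 leqNgt hr !coef_zero.
  by rewrite hr subnn coefC eqxx coef_mono3 !eqxx.
rewrite mul0rn; case: ltnP => _; first by rewrite !coef_zero.
by rewrite coefC; case: eqP => _; rewrite ?coef_mono3 ?hn // !coef_zero.
Qed.

(** Links the degree condition on coefficients used by [homog] to [tform]. The coefficient function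
    stays abstract; [homog_tform] supplies that of the nested encoding. *)
Lemma coef_tform t f :
  (forall i j k, coef f i j k != 0 -> (i + j + k)%N = t) <-> tform t f.
Proof.
rewrite /tform; split=> [hf|ef i j k].
  apply: (@mono3_ind (fun g => theta R g = g%:P * 'X^t)) => [|g h eg eh|i j k /hf <-].
  - by rewrite !rmorph0 mul0r.
  - by rewrite !rmorphD eg eh mulrDl.
  - exact: theta_mono.
apply: contra_neq_eq => nt.
have := coef_theta f (i + j + k) i j k.
rewrite eqxx mulr1n ef coefMXn coefC subn_eq0.
by case: ltngtP nt => //= _ _; rewrite ?coef_zero => <-.
Qed.

End Coefficients.

Section NestedPolynomials.
Variable K : fieldType.
Implicit Types f g : R3 K.

HB.instance Definition _ :=
  GRing.RMorphism.copy (@cst3 K) (polyC \o polyC \o polyC).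

Definition R3_X0 : R3 K := 'X%:P%:P.
Definition R3_X1 : R3 K := 'X%:P.
Definition R3_X2 : R3 K := 'X.

Lemma R3_ind (T : R3 K -> Prop) :
  (forall c, T (cst3 c)) -> T R3_X0 -> T R3_X1 -> T R3_X2 ->
  (forall f g, T f -> T g -> T (f + g)) ->
  (forall f g, T f -> T g -> T (f * g)) -> forall f, T f.
Proof.
move=> Tc T0 T1 T2 TD TM.
have T'0 : T 0 by have := Tc 0; rewrite rmorph0.
have TC0 (p : {poly K}) : T p%:P%:P.
  elim/poly_ind: p => [|p c IH]; first by rewrite !polyC0.
  rewrite !polyCD !polyCM; apply: TD; last exact: Tc.
  by apply: TM => //; exact: T0.
have TC1 (p : {poly {poly K}}) : T p%:P.
  elim/poly_ind: p => [|p c IH]; first by rewrite !polyC0.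
  rewrite !polyCD !polyCM; apply: TD; last exact: TC0.
  by apply: TM => //; exact: T1.
elim/poly_ind => // p c IH.
apply: TD; last exact: TC1.
by apply: TM => //; exact: T2.
Qed.

Section Sub.
Variables (S : comNzRingType) (phi : {rmorphism K -> S}) (a b c : S).

Definition sub0 : {rmorphism {poly K} -> S} :=
  horner_morph (fun y => mulrC a (phi y)).
Definition sub1 : {rmorphism {poly {poly K}} -> S} :=
  horner_morph (fun y => mulrC b (sub0 y)).
Definition R3_subst : {rmorphism R3 K -> S} :=
  horner_morph (fun y => mulrC c (sub1 y)).

Lemma R3_substC y : R3_subst (cst3 y) = phi y.
Proof. by do 3 rewrite [LHS]horner_morphC. Qed.
Lemma R3_substX0 : R3_subst R3_X0 = a.
Proof. by do 2 rewrite [LHS]horner_morphC; rewrite [LHS]horner_morphX. Qed.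
Lemma R3_substX1 : R3_subst R3_X1 = b.
Proof. by rewrite [LHS]horner_morphC [LHS]horner_morphX. Qed.
Lemma R3_substX2 : R3_subst R3_X2 = c.
Proof. exact: horner_morphX. Qed.
Definition R3_substE := (R3_substC, R3_substX0, R3_substX1, R3_substX2).
End Sub.

Lemma eval3E f p : eval3 f p = R3_subst idfun (ptx p) (pty p) (ptz p) f.
Proof.
move: f; apply: R3_ind => [c||||f g|f g].
- by rewrite R3_substE /eval3 /cst3 !hornerC.
- by rewrite R3_substE /eval3 /R3_X0 !hornerE.
- by rewrite R3_substE /eval3 /R3_X1 !hornerE.
- by rewrite R3_substE /eval3 /R3_X2 !hornerE.
- by rewrite rmorphD /eval3 !hornerD => -> ->.
- by rewrite rmorphM /eval3 !hornerM => -> ->.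
Qed.

Definition R3_mono3 (c : K) (i j k : nat) : R3 K :=
  cst3 c * R3_X0 ^+ i * R3_X1 ^+ j * R3_X2 ^+ k.

Lemma R3_expand f : f = \sum_(k < size f) \sum_(j < size f`_k)
   \sum_(i < size (f`_k)`_j) R3_mono3 (coef3 f i j k) i j k.
Proof.
rewrite -{1}[f]coefK poly_def; apply: eq_bigr => k _.
rewrite -{1}[f`_k]coefK poly_def -mul_polyC rmorph_sum mulr_suml.
apply: eq_bigr => j _.
rewrite -{1}[(f`_k)`_j]coefK poly_def -!mul_polyC rmorphM rmorph_sum.
rewrite rmorph_sum mulr_suml mulr_suml; apply: eq_bigr => i _.
by rewrite -mul_polyC /R3_mono3 /cst3 /R3_X0 /R3_X1 /R3_X2 /coef3 !rmorphM !rmorphXn.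
Qed.

Lemma mono_ind (T : R3 K -> Prop) : T 0 ->
  (forall f g, T f -> T g -> T (f + g)) ->
  forall f, (forall i j k, coef3 f i j k != 0 -> T (R3_mono3 (coef3 f i j k) i j k)) ->
  T f.
Proof.
move=> T0 TD f Tm; rewrite [f]R3_expand.
elim/big_ind: _ => // k _; elim/big_ind: _ => // j _; elim/big_ind: _ => // i _.
have [->|] := eqVneq (coef3 f i j k) 0; last exact: Tm.
by rewrite /R3_mono3 rmorph0 !mul0r.
Qed.

Lemma coef3D f g i j k : coef3 (f + g) i j k = coef3 f i j k + coef3 g i j k.
Proof. by rewrite /coef3 !coefD. Qed.

Lemma coef3_mono c i j k i' j' k' :
  coef3 (R3_mono3 c i j k) i' j' k' = c *+ [&& i' == i, j' == j & k' == k].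
Proof.
have -> : R3_mono3 c i j k = (((c *: 'X^i)%:P * 'X^j)%:P * 'X^k).
  by rewrite /R3_mono3 /cst3 /R3_X0 /R3_X1 /R3_X2 -mul_polyC !rmorphM !rmorphXn.
rewrite /coef3 coefCM coefXn.
case: (k' == k); last by rewrite mulr0 !coef0 !andbF.
rewrite mulr1 coefCM coefXn.
case: (j' == j); last by rewrite mulr0 !coef0 andbF.
by rewrite mulr1 coefZ coefXn !andbT mulr_natr.
Qed.

Definition R3_polyring : polyring3 K :=
  Polyring3 R3_ind R3_substC R3_substX0 R3_substX1 R3_substX2.

Lemma homog_tform t f : homog t f <-> @tform K R3_polyring t f.
Proof.
apply: (@coef_tform K R3_polyring (@coef3 K) coef3D coef3_mono) => T T0 TD g.
exact: mono_ind.
Qed.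

Lemma IP_ptI p f : IP p f <-> @ptI K R3_polyring p f.
Proof. by split=> h l; have := h l; rewrite eval3E. Qed.

End NestedPolynomials.

(** * The configuration *)

Lemma idealX_iff (R : comNzRingType) (I I' : R -> Prop) m f :
  (forall g, I g <-> I' g) -> idealX I m f <-> idealX I' m f.
Proof.
by move=> II; split=> -[n [a [Ia ->]]]; exists n, a; split=> // j i; apply/II.
Qed.

Lemma onlE (K : fieldType) (p a : pt K) : onl p a = (dot a p == 0).
Proof. by []. Qed.

(** Among the lines (w^2, w, 1), those through a given point correspond to the roots of a nonzero
    polynomial of degree at most 2; [w] is a non-root of the product of these polynomials. *)
Lemma generic_line (K : closedFieldType) (I : finType) (P : I -> pt K) (D : pred I) :
  (forall i, D i -> nz3 (P i)) ->
  exists xi : pt K, ptz xi = 1 /\ forall i, D i -> dot xi (P i) != 0.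
Proof.
move=> Pnz; pose q i : {poly K} :=
  ((ptx (P i))%:P * 'X + (pty (P i))%:P) * 'X + (ptz (P i))%:P.
have /closed_nonrootP[w hw] : \prod_(i | D i) q i != 0.
  apply/prodf_neq0 => i Di; apply/eqP => qi; apply: (Pnz i Di).
  have c0 := congr1 (fun r : {poly K} => r`_0) qi.
  have c1 := congr1 (fun r : {poly K} => r`_1) qi.
  have c2 := congr1 (fun r : {poly K} => r`_2) qi.
  move: c0 c1 c2; rewrite /q !(coefD, coefMX, coefC) /= !(add0r, addr0).
  by case: (P i) => [[a b] c]; rewrite /ptx /pty /ptz /= => -> -> ->.
exists (w ^+ 2, w, 1); split=> // i Di.
move: hw; rewrite /root horner_prod => /prodf_neq0/(_ i Di).
rewrite /q !(hornerD, hornerM, hornerC, hornerX) /dot /ptx /pty /ptz /=.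
by congr (_ != 0); ring.
Qed.

Section TriangularConfiguration.
Variables (K : closedFieldType) (s : nat) (P : 'I_s -> 'I_s -> pt K).
Variable M : 'I_s -> pt K.
Hypothesis s_gt1 : (1 < s)%N.
Hypothesis P_nz : forall i j : 'I_s, (j <= i)%N -> nz3 (P i j).
Hypothesis P_inj : forall i j i' j' : 'I_s, (j <= i)%N -> (j' <= i')%N ->
  ((i != i') || (j != j')) -> ~ projeq (P i j) (P i' j').
Hypothesis M_nz : forall k, nz3 (M k).
Hypothesis M_inj : forall k k', k <> k' -> ~ projeq (M k) (M k').
Hypothesis M_card : forall k, npts_on P (M k) = s.
Hypothesis M_max : forall a : pt K, nz3 a -> npts_on P a = s ->
  exists k, projeq a (M k).

Local Notation T := ('I_s * 'I_s)%type.
Definition valid : {set T} := [set ij : T | (ij.2 <= ij.1)%N].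
Definition pnt (ij : T) := P ij.1 ij.2.
Definition on_line (a : pt K) : {set T} :=
  [set ij : T | (ij.2 <= ij.1)%N && onl (pnt ij) a].
Local Notation A k := (on_line (M k)).
Local Notation mul := (mult (fun k => A k)).

Lemma on_lineP a p : reflect (p \in valid /\ dot a (pnt p) = 0) (p \in on_line a).
Proof.
rewrite !inE onlE; by apply: (iffP andP) => -[-> /eqP h].
Qed.

Lemma pnt_nz p : p \in valid -> nz3 (pnt p).
Proof. by rewrite inE; apply: P_nz. Qed.

Lemma pnt_inj p q : p \in valid -> q \in valid -> projeq (pnt p) (pnt q) -> p = q.
Proof.
rewrite !inE => hp hq pq; apply/eqP; case: eqVneq => // npq; exfalso.
apply: (P_inj hp hq) pq; rewrite -negb_and; apply: contra npq => /andP[/eqP e1 /eqP e2].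
by rewrite [p]surjective_pairing [q]surjective_pairing e1 e2.
Qed.

Lemma on_line_meet a b : nz3 a -> nz3 b -> ~ projeq a b ->
  (#|on_line a :&: on_line b| <= 1)%N.
Proof.
move=> ha hb ab; apply/card_le1_eqP => p q.
rewrite !inE -!andbA => /and4P[vp /eqP ap _ /eqP bp] /and4P[vq /eqP aq _ /eqP bq].
have vp' : p \in valid by rewrite inE.
have vq' : q \in valid by rewrite inE.
apply: pnt_inj => //.
by apply: (meet_unique ha hb ab) => //; apply: pnt_nz.
Qed.

Lemma A_sub k : A k \subset valid.
Proof. by apply/subsetP => p /on_lineP[]. Qed.

Lemma A_meet k l : k != l -> (#|A k :&: A l| <= 1)%N.
Proof. by move=> kl; apply: on_line_meet => //; apply: M_inj; apply/eqP. Qed.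

Let mult_meet := mult_and_meet A_sub M_card A_meet (card_triangle s).
Let simple_ex := simple_point A_sub M_card A_meet (card_triangle s).

Lemma simple_points : exists q : 'I_s -> T, forall k,
  [/\ q k \in A k, mul (q k) = 1%N & forall p, p \in A k -> mul p = 1%N -> p = q k].
Proof. exact: (fin_all_exists simple_ex). Qed.

Lemma mult1_unique p k l : mul p = 1%N -> p \in A k -> p \in A l -> k = l.
Proof.
move=> /eqP/cards1P[i hi] pk pl.
have : k \in [set i] by rewrite -hi inE.
have : l \in [set i] by rewrite -hi inE.
by rewrite !inE => /eqP -> /eqP ->.
Qed.

(* A line through all the simple points would contain [s] points. *)
Lemma simple_triangle (q : 'I_s -> T) :
  (forall k, q k \in A k /\ mul (q k) = 1%N) ->
  forall k, exists l l', [/\ l != k, l' != k &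
     det (pnt (q k)) (pnt (q l)) (pnt (q l')) != 0].
Proof.
move=> hq k; have [l lk] := other_index s_gt1 k; exists l.
have qv i : q i \in valid by have [qi _] := hq i; apply: subsetP (A_sub i) _ qi.
have q_inj i i' : q i = q i' -> i = i'.
  move=> e; have [qi m1] := hq i; have [qi' _] := hq i'.
  by rewrite -e in qi'; exact: mult1_unique m1 qi qi'.
have [l' /andP[l'k d0]|none] :=
  pickP (fun l' => (l' != k) && (det (pnt (q k)) (pnt (q l)) (pnt (q l')) != 0)).
  by exists l'.
pose a := cross (pnt (q k)) (pnt (q l)).
have qa i : q i \in on_line a.
  apply/on_lineP; split=> //; have [->|ik] := eqVneq i k; first exact: dot_crossl.
  by apply/eqP; have := none i; rewrite ik /= => /negbFE.
have a_nz : nz3 a.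
  move=> a0; have : q k = q l.
    by apply: pnt_inj => //; apply: cross_eq0_projeq => //; apply: pnt_nz.
  by move/q_inj => e; rewrite e eqxx in lk.
(* Otherwise [q j] with j different from i would lie on both [M i] and [M j], although it is
   simple. *)
have aM i : ~ projeq a (M i).
  move=> [c [c0 ac]]; have [j ji] := other_index s_gt1 i.
  have [_ ] := on_lineP _ _ (qa j); rewrite ac dot_scalel => /eqP.
  rewrite mulf_eq0 (negbTE c0) /= => /eqP Mj.
  have [qj m1] := hq j.
  have qji : q j \in A i by apply/on_lineP.
  by rewrite (mult1_unique m1 qj qji) eqxx in ji.
(* At most s: every point of the configuration lies on some [M i], and each [M i] meets [a] in at
   most one of them. At least s: the [q i] are distinct. *)
have a_card : npts_on P a = s.
  apply/eqP; rewrite eqn_leq; apply/andP; split.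
    rewrite -[X in (X <= _)%N]/#|on_line a| -sum1_card.
    apply: (@leq_trans (\sum_(p in on_line a) mul p)).
      apply: leq_sum => p /on_lineP[pv _].
      by have [m12 _] := mult_meet; have /andP[] := m12 p pv.
    rewrite sum_mult -[X in (_ <= X)%N]card_ord -sum1_card.
    by apply: leq_sum => i _; apply: on_line_meet => // /projeq_sym; exact: aM.
  rewrite -[X in (X <= _)%N]card_ord -(card_imset predT q_inj).
  by apply: subset_leq_card; apply/subsetP => _ /imsetP[i _ ->]; exact: qa.
by have [i /aM] := M_max a_nz a_card.
Qed.

Theorem triangular_hilbert (R : polyring3 K) N : exists r1 b1 r2 b2 : nat,
  let fatP (f : R) := forall i j : 'I_s, (j <= i)%N -> idealX (ptI (P i j)) N.+2 f in
  [/\ spans_dim (@tform K R (N.+2 * s - 1)) r1,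
      spans_dim (fun f : R => tform (N.+2 * s - 1) f /\ fatP f) b1,
      spans_dim (@tform K R (N.+2 * s - 2)) r2,
      spans_dim (fun f : R => tform (N.+2 * s - 2) f /\ fatP f) b2 &
      (r1 + b2 = r2 + b1 + s)%N].
Proof.
have [q hq] := simple_points.
have [xi [xi_z xiP]] := @generic_line K _ pnt (fun p => p \in valid) (fun p => @pnt_nz p).
have [m12 meet] := mult_meet.
pose X p := exists2 ij, ij \in valid & p = pnt ij.
have qA k : q k \in A k by have [] := hq k.
have qv k : q k \in valid by apply: subsetP (A_sub k) _ (qA k).
have [||||||r1 [b1 [r2 [b2 [h1 h2 h3 h4 h5]]]]] :=
  @hilbert_difference K R xi (uniq_seq_exists K) s N M (fun k => pnt (q k)) X s_gt1 xi_z.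
- move=> j k jk; have /eqP/cards1P[p hp] := meet j k jk.
  have : p \in A j :&: A k by rewrite hp inE.
  rewrite inE => /andP[/on_lineP[pv Mj] /on_lineP[_ Mk]].
  apply: (det_meet _ _ _ _ Mj Mk) => //; [|exact: pnt_nz|exact: xiP].
  by apply: M_inj; apply/eqP.
- by move=> k; apply: xiP; exact: qv.
- by move=> k; have /on_lineP[] := qA k.
- by apply: simple_triangle => k; have [] := hq k.
- move=> _ [p pv ->]; split; first exact: xiP.
  (* A point of multiplicity 1 is the simple point of the line through it; one of multiplicity 2 is
     the meeting point of two lines. *)
  have /andP[m0 m2] := m12 p pv; have [m1|m1] := eqVneq (mul p) 1%N.
    right; have : (0 < mul p)%N by [].
    rewrite card_gt0 => /set0Pn[k]; rewrite [k \in _]in_set => pk; exists k.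
    by have [_ _ /(_ p pk m1) ->] := hq k.
  left; have : (1 < mul p)%N by case: (mul p) m0 m1 => [|[|]].
  move/card_gt1P => [j [k [pj pk jk]]]; exists j, k.
  move: pj pk; rewrite [j \in _]in_set [k \in _]in_set.
  by move=> /on_lineP[_ ->] /on_lineP[_ ->].
- move=> k; have Ak : #|A k| = s := M_card k.
  exists (fun i => pnt (enum_val (cast_ord (esym Ak) i))).
  have ev i : enum_val (cast_ord (esym Ak) i) \in A k by exact: enum_valP.
  split=> [i|i|i j ij].
  + by have /on_lineP[pv _] := ev i; eexists; last reflexivity.
  + by have /on_lineP[_] := ev i.
  + have /on_lineP[iv _] := ev i; have /on_lineP[jv _] := ev j.
    by move/(pnt_inj iv jv)/enum_val_inj/cast_ord_inj => e; rewrite e eqxx in ij.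
have fatE f : fat X N.+2 f <->
    (forall i j : 'I_s, (j <= i)%N -> idealX (ptI (P i j)) N.+2 f).
  split=> h; first by move=> i j ij; apply: h; exists (i, j); rewrite ?inE.
  by move=> _ [[i j] ij ->]; apply: h; rewrite inE in ij.
exists r1, b1, r2, b2; split=> //.
  by apply: spans_dim_iff h2 => f; rewrite fatE.
by apply: spans_dim_iff h4 => f; rewrite fatE.
Qed.

End TriangularConfiguration.

Theorem theorem4p5 (K : closedFieldType) (s : nat)
    (P : 'I_s -> 'I_s -> pt K) (L : 'I_s -> pt K) :
  (2 <= s)%N -> kconfig_1s P L -> exactly_s_lines P ->
  forall m : nat, (2 <= m)%N ->
    exists h1 h2 : int,
      hilb (fatI P m) (m * s - 1) h1 /\
      hilb (fatI P m) (m * s - 2) h2 /\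
      h1 - h2 = s%:Z.
Proof.
move=> s_gt1 [P_nz P_inj _ _ _] [M [M_nz M_inj M_card M_max]] [|[|N]] // _.
have [r1 [b1 [r2 [b2 [h1 h2 h3 h4 h5]]]]] := triangular_hilbert s_gt1 P_nz
  P_inj M_nz M_inj M_card M_max (R3_polyring K) N.
have fatE f : (forall i j : 'I_s, (j <= i)%N ->
    @idealX (R3_polyring K) (ptI (P i j)) N.+2 f) <-> fatI P N.+2 f.
  split=> h i j ij.
    by apply: (idealX_iff (R := R3_polyring K) _ _ (fun g => IP_ptI (P i j) g)).2; exact: h.
  by apply: (idealX_iff (R := R3_polyring K) _ _ (fun g => IP_ptI (P i j) g)).1; exact: h.
have homE t r : spans_dim (@tform K (R3_polyring K) t) r -> isdim (@homog K t) r.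
  move=> h; exact (@spans_dim_iff K (R3_polyring K) _ (@homog K t) r
    (fun f => iff_sym (homog_tform t f)) h).
have fatdimE t b : spans_dim (fun f : R3_polyring K => tform t f /\
    forall i j : 'I_s, (j <= i)%N -> idealX (ptI (P i j)) N.+2 f) b ->
    isdim (fun f => homog t f /\ fatI P N.+2 f) b.
  move=> h; refine (@spans_dim_iff K (R3_polyring K) _
    (fun f : R3 K => homog t f /\ fatI P N.+2 f) b _ h) => f.
  by rewrite fatE; split=> -[? ?]; split=> //; apply/homog_tform.
exists (r1%:Z - b1%:Z), (r2%:Z - b2%:Z); split; [|split].
- by exists r1, b1; split; [exact: homE|split=> //; exact: fatdimE].
- by exists r2, b2; split; [exact: homE|split=> //; exact: fatdimE].
- lia.
Qed.
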